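(* The Laplace transforms $F_{0,1}^H$ and $F_{0,2}^H$ of the single Hurwitz numbers for the unstable cases $(g,n)=(0,1)$ and $(0,2)$ are given by $$F_{0,1}^H(t)=\frac12\left(1-\frac{1}{t^2}\right)$$ and $$F_{0,2}^H(t_1,t_2)=\log\left(\frac{z_1-z_2}{x_1-x_2}\right)-(z_1+z_2)+1,$$ where $x_i=z_ie^{1-z_i}$ and $z_i=\frac{t_i-1}{t_i}$.
   Context: A Hurwitz cover is a holomorphic map $f:C\to\mathbb{P}^1$ from a connected nonsingular projective curve of genus $g$ with only simple ramification except over $\infty$. Its profile is the partition $\mu=(\mu_1\ge\dots\ge\mu_n>0)$ of the degree $|\mu|$ given by the ramification indices over $\infty$. The single Hurwitz number $h_{g,\mu}$ is the number of Hurwitz covers of genus $g$ and profile $\mu$ with a prescribed set of $r=2g-2+n+|\mu|$ labeled simple branch points in $\mathbb{P}^1\setminus\{\infty\}$, counted up to isomorphism with weight $1/|\mathrm{Aut} f|$. Put $$H_g(\mu)=\frac{|\mathrm{Aut}(\mu)|}{(2g-2+n+|\mu|)!}\,h_{g,\mu},$$ where $\mathrm{Aut}(\mu)$ is the group permuting equal parts of $\mu$; $H_g(\mu)$ is regarded as a symmetric function of $\mu\in\mathbb{Z}_+^n$ ($\mathbb{Z}_+$ = positive integers). The values in the unstable cases are the known ones $$H_0((d))=\frac{d^{d-2}}{d!},\qquad H_0((\mu_1,\mu_2))=\frac{1}{\mu_1+\mu_2}\cdot\frac{\mu_1^{\mu_1}}{\mu_1!}\cdot\frac{\mu_2^{\mu_2}}{\mu_2!}.$$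 The Laplace transform is $$F_{g,n}^H(t_1,\dots,t_n)=\sum_{\mu\in\mathbb{Z}_+^n}H_g(\mu)\,e^{-(\mu_1(w_1+1)+\cdots+\mu_n(w_n+1))},$$ where $x_i=e^{-w_i}$, and near $x=0$ $$z=\sum_{\mu=1}^\infty\frac{\mu^{\mu-1}}{\mu!}e^{-\mu}x^\mu,\qquad t-1=\sum_{\mu=1}^\infty\frac{\mu^{\mu}}{\mu!}e^{-\mu}x^\mu,$$ so that $x=ze^{1-z}$ and $z=\frac{t-1}{t}$ ($x=0$ corresponds to $z=0$, $t=1$). The identities are identities of holomorphic functions for $|x_i|<1$ (near $x_i=0$), with the branch of the logarithm for which the right-hand side of the second formula vanishes at $x_1=x_2=0$. *)

(* Defs.v *)
From HB Require Import structures.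
From mathcomp Require Import all_boot all_order all_algebra all_fingroup.
From mathcomp Require Import finmap complex.
From mathcomp Require Import all_classical all_reals all_analysis.
From mathcomp Require Import summability.
Set Implicit Arguments.
Unset Strict Implicit.
Unset Printing Implicit Defensive.
Import Order.TTheory GRing.Theory Num.Theory numFieldNormedType.Exports.
Local Open Scope classical_set_scope.
Local Open Scope ring_scope.

(* The complex numbers, as a numClosedFieldType so that the norm topology is
   inferred. *)
Definition Cplx (R : realType) : numClosedFieldType := R[i]%C.

Definition cexp (R : realType) (z : Cplx R) : Cplx R :=
  Complex (expR (complex.Re z) * cos (complex.Im z))
          (expR (complex.Re z) * sin (complex.Im z)).

Definition holomorphic_on (R : realType) (U : set (Cplx R))
    (f : Cplx R -> Cplx R) : Prop :=
  forall z, U z -> derivable f z 1.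

(* A chart is a map cdom -> C with inverse cinv; the values of cfun outside cdom
   and of cinv outside cfun @` cdom are irrelevant. *)
Record chart (R : realType) (T : Type) := Chart {
  cdom : set T;
  cfun : T -> Cplx R;
  cinv : Cplx R -> T }.

Definition crange (R : realType) (T : Type) (c : chart R T) : set (Cplx R) :=
  cfun c @` cdom c.

Definition is_chart (R : realType) (T : topologicalType) (c : chart R T) : Prop :=
  [/\ open (cdom c), open (crange c),
      forall p, cdom c p -> cinv c (cfun c p) = p,
      {within cdom c, continuous (cfun c)} &
      {within crange c, continuous (cinv c)}].

Definition transition (R : realType) (T : Type) (c1 c2 : chart R T) :
    Cplx R -> Cplx R :=
  cfun c2 \o cinv c1.

Definition holomorphic_atlas (R : realType) (T : topologicalType)
    (A : set (chart R T)) : Prop :=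
  [/\ forall c, A c -> is_chart c,
      forall p, exists2 c, A c & cdom c p &
      forall c1 c2, A c1 -> A c2 ->
        holomorphic_on (cfun c1 @` (cdom c1 `&` cdom c2)) (transition c1 c2)].

(* Connected nonsingular projective curves over C are taken as connected compact
   Riemann surfaces. *)
Definition compact_riemann_surface (R : realType) (T : topologicalType)
    (A : set (chart R T)) : Prop :=
  [/\ holomorphic_atlas A, hausdorff_space T, compact [set: T],
      connected [set: T] & [set: T] !=set0].

Definition holomorphic_map (R : realType) (T T' : topologicalType)
    (A : set (chart R T)) (A' : set (chart R T')) (f : T -> T') : Prop :=
  continuous f /\
  forall c c', A c -> A' c' ->
    holomorphic_on (cfun c @` (cdom c `&` f @^-1` cdom c'))
                   (cfun c' \o f \o cinv c).

Definition biholomorphic (R : realType) (T T' : topologicalType)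
    (A : set (chart R T)) (A' : set (chart R T')) (f : T -> T') : Prop :=
  holomorphic_map A A' f /\
  exists f' : T' -> T, [/\ holomorphic_map A' A f', cancel f f' & cancel f' f].

(* In local coordinates F z - F z0 = (z - z0)^k g(z) with g holomorphic near z0
   and g z0 != 0. *)
Definition ramification_index (R : realType) (T T' : topologicalType)
    (A : set (chart R T)) (A' : set (chart R T')) (f : T -> T') (p : T)
    (k : nat) : Prop :=
  forall c c', A c -> A' c' -> cdom c p -> cdom c' (f p) ->
    let F := cfun c' \o f \o cinv c in
    let z0 := cfun c p in
    exists g : Cplx R -> Cplx R,
      [/\ \forall z \near z0, derivable g z 1, g z0 != 0 &
          \forall z \near z0, F z - F z0 = (z - z0) ^+ k * g z].

(* A holomorphic 1-form is given by its coefficient w c (z) dz in every chart c. *)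
Definition holomorphic_form (R : realType) (T : topologicalType)
    (A : set (chart R T)) (w : chart R T -> Cplx R -> Cplx R) : Prop :=
  (forall c, A c -> holomorphic_on (crange c) (w c)) /\
  (forall c1 c2, A c1 -> A c2 ->
    forall z, (cfun c1 @` (cdom c1 `&` cdom c2)) z ->
      w c1 z = w c2 (transition c1 c2 z) * 'D_1 (transition c1 c2) z).

(* The genus is the dimension of the space of holomorphic 1-forms: e_0, ...,
   e_(g-1) is a basis of it. *)
Definition has_genus (R : realType) (T : topologicalType) (A : set (chart R T))
    (g : nat) : Prop :=
  exists e : 'I_g -> chart R T -> Cplx R -> Cplx R,
    (forall i, holomorphic_form A (e i)) /\
    (forall w, holomorphic_form A w ->
      exists! a : {ffun 'I_g -> Cplx R},
        forall c z, A c -> crange c z -> w c z = \sum_i a i * e i c z).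

(* P^1 = C + {None}, where None is the point at infinity. *)
Definition P1 (R : realType) : topologicalType :=
  one_point_compactification (Cplx R).

Definition P1_affine (R : realType) : chart R (P1 R) :=
  @Chart R (P1 R) [set p | p <> None] (fun p => if p is Some z then z else 0) Some.

Definition P1_infinity (R : realType) : chart R (P1 R) :=
  @Chart R (P1 R) [set p | p <> Some 0]
    (fun p => if p is Some z then z^-1 else 0)
    (fun z => if z == 0 then None else Some z^-1).

Definition P1_atlas (R : realType) : set (chart R (P1 R)) :=
  [set P1_affine R; P1_infinity R].

(* r = 2g - 2 + n + |mu|; the truncated subtraction is exact when n > 0 and the
   parts of mu are positive. *)
Definition num_branch (g : nat) (mu : seq nat) : nat :=
  (2 * g + size mu + sumn mu - 2)%N.

Definition has_profile (R : realType) (T : topologicalType) (A : set (chart R T))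
    (f : T -> P1 R) (mu : seq nat) : Prop :=
  exists (s : seq T) (e : T -> nat),
    [/\ uniq s, forall p, p \in s <-> f p = None,
        forall p, p \in s -> ramification_index A (@P1_atlas R) f p (e p) &
        perm_eq [seq e p | p <- s] mu].

Definition simple_over (R : realType) (T : topologicalType) (A : set (chart R T))
    (f : T -> P1 R) (y : Cplx R) : Prop :=
  exists p, [/\ f p = Some y, ramification_index A (@P1_atlas R) f p 2 &
    forall q, f q = Some y -> q <> p -> ramification_index A (@P1_atlas R) f q 1].

Definition unramified_over (R : realType) (T : topologicalType)
    (A : set (chart R T)) (f : T -> P1 R) (y : Cplx R) : Prop :=
  forall q, f q = Some y -> ramification_index A (@P1_atlas R) f q 1.

(* Hurwitz covers of genus g and profile mu whose finite branch points are
   exactly the elements of b. *)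
Record hurwitz_cover (R : realType) (g : nat) (mu : seq nat) (b : seq (Cplx R)) :=
  HurwitzCover {
    hc_curve : topologicalType;
    hc_atlas : set (chart R hc_curve);
    hc_map : hc_curve -> P1 R;
    hc_surface : compact_riemann_surface hc_atlas;
    hc_genus : has_genus hc_atlas g;
    hc_holomorphic : holomorphic_map hc_atlas (@P1_atlas R) hc_map;
    hc_profile : has_profile hc_atlas hc_map mu;
    hc_simple : forall y, y \in b -> simple_over hc_atlas hc_map y;
    hc_unramified : forall y, y \notin b -> unramified_over hc_atlas hc_map y }.

Arguments hc_curve {R g mu b} _.
Arguments hc_atlas {R g mu b} _.
Arguments hc_map {R g mu b} _ _.

Definition cover_iso (R : realType) (g : nat) (mu : seq nat) (b : seq (Cplx R))
    (X Y : hurwitz_cover g mu b) (phi : hc_curve X -> hc_curve Y) : Prop :=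
  biholomorphic (hc_atlas X) (hc_atlas Y) phi /\
  forall p, hc_map Y (phi p) = hc_map X p.

Definition cover_aut (R : realType) (g : nat) (mu : seq nat) (b : seq (Cplx R))
    (X : hurwitz_cover g mu b) : set (hc_curve X -> hc_curve X) :=
  [set phi | cover_iso phi].

(* h is the weighted count: X_0, ..., X_(N-1) represent each isomorphism class
   exactly once, a i = |Aut X_i| and h is the sum of the 1 / a i; the count is
   the same for every choice b of r distinct branch points. *)
Definition is_hurwitz_number (R : realType) (g : nat) (mu : seq nat) (h : rat) :
    Prop :=
  forall b : (num_branch g mu).-tuple (Cplx R), uniq b ->
  exists (N : nat) (X : 'I_N -> hurwitz_cover g mu b) (a : 'I_N -> nat),
    [/\ forall i j (phi : hc_curve (X i) -> hc_curve (X j)),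
          cover_iso phi -> i = j,
        forall Y : hurwitz_cover g mu b,
          exists i (phi : hc_curve (X i) -> hc_curve Y), cover_iso phi,
        forall i, (cover_aut (X := X i) #= `I_(a i))%card &
        h = \sum_(i < N) (a i)%:R^-1].

(* h_(g, mu) *)
Definition hurwitz_number (R : realType) (g : nat) (mu : seq nat) : rat :=
  xget 0 [set h | is_hurwitz_number R g mu h].

(* |Aut(mu)| *)
Definition aut_card (n : nat) (mu : n.-tuple nat) : nat :=
  #|[set s : 'S_n | [forall i, tnth mu (s i) == tnth mu i]]|.

(* H_g(mu) *)
Definition hurwitz_H (R : realType) (g n : nat) (mu : n.-tuple nat) : rat :=
  (aut_card mu)%:R / ((num_branch g mu)`!)%:R * hurwitz_number R g mu.

Definition posint := {m : nat | (0 < m)%N}.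

Definition parts (n : nat) (m : n.-tuple posint) : n.-tuple nat :=
  map_tuple (fun k : posint => sval k) m.

(* Term of the Laplace transform, as a function of w. *)
Definition laplace_term (R : realType) (g n : nat) (w : n.-tuple (Cplx R))
    (m : n.-tuple posint) : Cplx R :=
  ratr (hurwitz_H R g (parts m)) *
  cexp (- \sum_(i < n) (tnth (parts m) i)%:R * (tnth w i + 1)).

(* The same term in the variables x_i = e^(-w_i); unlike the w_i, the x_i may
   vanish. *)
Definition laplace_term_x (R : realType) (g n : nat) (x : n.-tuple (Cplx R))
    (m : n.-tuple posint) : Cplx R :=
  ratr (hurwitz_H R g (parts m)) *
  \prod_(i < n) (cexp (- (tnth (parts m) i)%:R) * tnth x i ^+ tnth (parts m) i).

(* Sums over Z_+^n are unordered sums: limits along the finite subsets. *)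
Definition sum_converges (R : realType) (I : choiceType) (u : I -> Cplx R) : Prop :=
  cvg (partial_sum u @ totally).

(* F_(g,n)^H as a function of w *)
Definition laplace_F (R : realType) (g n : nat) (w : n.-tuple (Cplx R)) : Cplx R :=
  sum (laplace_term g w).

(* F_(g,n)^H as a function of x *)
Definition laplace_Fx (R : realType) (g n : nat) (x : n.-tuple (Cplx R)) : Cplx R :=
  sum (laplace_term_x g x).

Definition z_of (R : realType) (x : Cplx R) : Cplx R :=
  \big[+%R/0]_(1 <= m <oo)
    ((m ^ m.-1)%:R / (m`!)%:R * cexp (- m%:R) * x ^+ m).

Definition t_of (R : realType) (x : Cplx R) : Cplx R :=
  1 + \big[+%R/0]_(1 <= m <oo)
        ((m ^ m)%:R / (m`!)%:R * cexp (- m%:R) * x ^+ m).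

(* L is the branch on the bidisc |x_1|, |x_2| < 1 of
   log ((z_1 - z_2) / (x_1 - x_2)) with L(0, 0) = -1. By continuity, exp L on
   the diagonal is the value dz/dx of the extended quotient. *)
Definition log_quotient_branch (R : realType) (L : Cplx R * Cplx R -> Cplx R) :
    Prop :=
  [/\ forall x1 x2, `|x1| < 1 -> `|x2| < 1 -> {for (x1, x2), continuous L},
      L (0, 0) = -1 &
      forall x1 x2, `|x1| < 1 -> `|x2| < 1 -> x1 != x2 ->
        cexp (L (x1, x2)) = (z_of x1 - z_of x2) / (x1 - x2)].

(* Main.v *)
Require Import Defs.
From HB Require Import structures.
From mathcomp Require Import all_boot all_order all_algebra all_fingroup.
From mathcomp Require Import finmap complex.
From mathcomp Require Import all_classical all_reals all_analysis.
From mathcomp Require Import summability.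
From mathcomp Require Import ring lra zify.
(**
The power series z and t satisfy t z = t - 1 coefficient by coefficient; this
is Abel's identity, obtained from the vanishing of the m-th differences of a
polynomial of degree less than m.

Let theta be the Euler operator, which multiplies the degree n part by n. Then
theta z = t - 1, and theta F_(0,1) = z = theta (z - z^2 / 2), while
1 - 1 / t = z; this gives the first formula. In two variables,
P = F_(0,2) + z1 + z2 - 1 satisfies theta P = t1 t2 - 1, and
theta (z1 - z2) = t1 - t2 = t1 t2 (z1 - z2). Restricted to a ray
s |-> (s x1, s x2), the functions (z1 - z2) / (s (x1 - x2)) and exp P therefore
solve the same linear differential equation with the same value at s = 0, so
they are equal, and P itself is the required branch of the logarithm. The
equation x = z e^(1 - z) follows in the same way from theta z = t z.
*)
Set Implicit Arguments.
Unset Strict Implicit.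
Unset Printing Implicit Defensive.
Import Order.TTheory GRing.Theory Num.Theory numFieldNormedType.Exports.
Local Open Scope classical_set_scope.
Local Open Scope ring_scope.

(** * Finite differences, Abel's identity and the coefficient form of [z t = t - 1] *)

(** Induction on [j]: the absorption [k C(m, k) = m C(m - 1, k - 1)] uses up one factor [k] and
    lowers [m] by one. Expanding the remaining [(k + 1) ^ j] in powers of [k] leaves sums of the
    same shape with smaller exponents. *)
Lemma sum_signed_bin_pow (F : comNzRingType) (m j : nat) : (j < m)%N ->
  \sum_(k < m.+1) (-1) ^+ k * 'C(m, k)%:R * k%:R ^+ j = 0 :> F.
Proof.
elim/ltn_ind: j m => -[_|j IH] m.
  case: m => // m _.
  under eq_bigr do rewrite expr0 mulr1.
  have := exprDn (1 : F) (-1) m.+1.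
  rewrite subrr expr0n mulr0n => e; rewrite [RHS]e; apply: eq_bigr => k _.
  by rewrite expr1n mul1r mulr_natr.
case: m => // m; rewrite ltnS => ltjm.
rewrite big_ord_recl /= expr0n /= mulr0 add0r.
transitivity (- m.+1%:R *
    \sum_(l < j.+1) 'C(j, l)%:R *
      \sum_(k < m.+1) (-1) ^+ k * 'C(m, k)%:R * (k%:R ^+ l : F)).
  under [in RHS]eq_bigr do rewrite mulr_sumr.
  rewrite exchange_big mulr_sumr /=; apply: eq_bigr => k _.
  rewrite /bump /= add1n.
  have e1 : k.+1%:R * 'C(m.+1, k.+1)%:R = m.+1%:R * 'C(m, k)%:R :> F.
    by rewrite -!natrM mul_bin_diag.
  have e2 : k.+1%:R ^+ j = \sum_(l < j.+1) 'C(j, l)%:R * k%:R ^+ l :> F.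
    rewrite -nat1r exprDn; apply: eq_bigr => l _.
    by rewrite expr1n mul1r mulr_natl.
  transitivity (- (-1) ^+ k * (m.+1%:R * 'C(m, k)%:R) * k.+1%:R ^+ j : F).
    by rewrite -e1 !exprS; ring.
  rewrite e2 !mulr_sumr; apply: eq_bigr => l _; ring.
rewrite big1 ?mulr0// => l _; rewrite IH ?mulr0 ?ltn_ord //.
by rewrite (leq_trans _ ltjm).
Qed.

(** Both sides are the multinomial coefficient [n! / (i! j! (n - i - j)!)]; they are compared after
    clearing denominators. *)
Lemma bin_trinomial_revision (n i j : nat) : (i + j <= n)%N ->
  ('C(n, i) * 'C(n - i, j) = 'C(n, j) * 'C(n - j, i))%N.
Proof.
move=> ijn.
have in_ : (i <= n)%N by rewrite (leq_trans _ ijn) ?leq_addr.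
have jn : (j <= n)%N by rewrite (leq_trans _ ijn) ?leq_addl.
have e1 := bin_fact in_; have e2 := bin_fact jn.
have /bin_fact e3 : (j <= n - i)%N by rewrite leq_subRL.
have /bin_fact e4 : (i <= n - j)%N by rewrite leq_subRL // addnC.
have E : (n - i - j = n - j - i)%N by rewrite subnAC.
rewrite E in e3.
apply/eqP; rewrite -(eqn_pmul2r (fact_gt0 i)) -(eqn_pmul2r (fact_gt0 j)).
rewrite -(eqn_pmul2r (fact_gt0 (n - j - i))); apply/eqP.
transitivity (n`!).
  rewrite -[RHS]e1 -[in RHS]e3; lia.
rewrite -[LHS]e2 -[in LHS]e4; lia.
Qed.

(** After expansion in powers of [y], the coefficient of [y ^ j] is, up to a factor, an alternating
    binomial sum of order [n - j + 1] over values of [X ^ (n - j)]. It vanishes for [j < n], and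
    only [y ^ n] survives. *)
Lemma abel_identity (F : comNzRingType) (y : F) (n : nat) :
  \sum_(i < n.+1) 'C(n.+1, i.+1)%:R * i.+1%:R ^+ i * (y - i.+1%:R) ^+ (n - i)
  = n.+1%:R * y ^+ n.
Proof.
(* The coefficient of [y ^ j] in the [i]-th summand, set to 0 outside the triangle [i + j <= n] so
   that the two sums can be exchanged. *)
pose a (i j : nat) : F := if (i + j <= n)%N then
  (-1) ^+ (n - j - i) * 'C(n.+1, j)%:R * 'C(n.+1 - j, i.+1)%:R * i.+1%:R ^+ (n - j)
  else 0.
transitivity (\sum_(i < n.+1) \sum_(j < n.+1) a i j * y ^+ j).
  apply: eq_bigr => i _.
  have ile : (i <= n)%N by rewrite -ltnS.
  set c := _ * i.+1%:R ^+ i; rewrite addrC; set b := - _.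
  rewrite exprDn mulr_sumr.
  have Hw : ((n - i).+1 <= n.+1)%N by rewrite ltnS leq_subr.
  rewrite (big_ord_widen n.+1
    (fun l => c * (b ^+ (n - i - l) * y ^+ l *+ 'C(n - i, l))) Hw).
  rewrite big_mkcond /=; apply: eq_bigr => j _.
  rewrite ltnS leq_subRL// /a; case: leqP => [ijn|_]; last by rewrite mul0r.
  have e : 'C(n.+1, i.+1)%:R * 'C(n - i, j)%:R
      = 'C(n.+1, j)%:R * 'C(n.+1 - j, i.+1)%:R :> F.
    by rewrite -!natrM -bin_trinomial_revision.
  rewrite -(mulrA _ 'C(n.+1, j)%:R) -e /c /b [(- _) ^+ _]exprNn -mulr_natr.
  have -> : (n - j = i + (n - i - j))%N by lia.
  by rewrite exprD addKn; ring.
rewrite exchange_big /=.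
transitivity (\sum_(j < n.+1) (if (j == n :> nat)%N then n.+1%:R * y ^+ n else 0)).
  apply: eq_bigr => j _; rewrite -mulr_suml.
  have jn : (j <= n)%N by rewrite -ltnS.
  have -> : \sum_(i < n.+1) a i j = 'C(n.+1, j)%:R * (-1) ^+ (n - j).+1 *
      \sum_(i < (n - j).+1) (-1) ^+ i.+1 * 'C((n - j).+1, i.+1)%:R * i.+1%:R ^+ (n - j).
    have Hw : ((n - j).+1 <= n.+1)%N by rewrite ltnS leq_subr.
    rewrite (big_ord_widen n.+1 (fun i => (-1) ^+ i.+1 * 'C((n - j).+1, i.+1)%:R
      * i.+1%:R ^+ (n - j)) Hw) [in RHS]big_mkcond mulr_sumr /=.
    apply: eq_bigr => i _.
    rewrite ltnS leq_subRL// addnC /a; case: leqP => [ijn|_]; last by rewrite mulr0.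
    have -> : (-1) ^+ (n - j).+1 = (-1) ^+ (n - j - i) * (-1) ^+ i.+1 :> F.
      by rewrite -exprD; congr (_ ^+ _); lia.
    rewrite subSn//.
    have sq : (-1) ^+ i.+1 * (-1) ^+ i.+1 = 1 :> F.
      by rewrite -exprD addnn -muln2 exprM sqrr_sign.
    move: ((-1) ^+ i.+1) ((-1) ^+ (n - j - i)) sq => s r sq.
    by rewrite -[LHS]mul1r -sq; ring.
  case: eqP => [->|/eqP jn'].
    by rewrite subnn big_ord1 binSn bin1 expr1 expr0; ring.
  have /(sum_signed_bin_pow F) : (n - j < (n - j).+1)%N by [].
  (* The full difference starts at [k = 0], where [0 ^ (n - j) = 0] because [j < n]. *)
  rewrite big_ord_recl /= expr0n subn_eq0 leqNgt ltn_neqAle jn' jn /= mulr0 add0r.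
  by under eq_bigr do rewrite /bump /= add1n; move=> ->; rewrite mulr0 mul0r.
by rewrite big_ord_recr /= eqxx big1 ?add0r// => i _; rewrite ltn_eqF.
Qed.

(** Coefficients of [t] in the variable [x / e], with constant term [0 ^ 0 = 1]. Divided by [n] they
    become [n ^ (n - 1) / n!], the exponential generating function of rooted labelled trees. *)
Definition tree_coef (F : numFieldType) (n : nat) : F := (n ^ n)%:R / n`!%:R.

Definition cauchy_prod (F : comNzRingType) (u v : nat -> F) (n : nat) : F :=
  \sum_(i < n.+1) u i * v (n - i)%N.

Lemma fact_neq0 (F : numFieldType) (n : nat) : n`!%:R != 0 :> F.
Proof. by rewrite pnatr_eq0 -lt0n fact_gt0. Qed.

(* The coefficient form of [z t = t - 1]; at [i = 0] the convention
   [x / 0 = 0] gives the constant term 0 of [z]. *)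
Lemma cauchy_prod_tree_coef (F : numFieldType) (n : nat) :
  cauchy_prod (fun i => tree_coef F i / i%:R) (tree_coef F) n
  = tree_coef F n - (n == 0)%:R.
Proof.
rewrite /cauchy_prod big_ord_recl invr0 mulr0 mul0r add0r.
case: n => [|n] /=; first by rewrite big_ord0 /tree_coef fact0 divr1 subrr.
(* Multiplied by [(n + 1)!], the claim is Abel's identity at [y = n + 1], where
   [y - (i + 1) = n - i]. *)
rewrite subr0; apply: (mulfI (fact_neq0 F n.+1)).
rewrite [in RHS]/tree_coef mulrCA divff ?fact_neq0// mulr1 expnS natrM.
rewrite natrX -abel_identity mulr_sumr; apply: eq_bigr => i _.
rewrite /bump /= add1n subSS.
have ile : (i <= n)%N by rewrite -ltnS.
rewrite -natrB; last by rewrite ltnS.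
rewrite subSS /tree_coef expnS natrM !natrX.
have H : n.+1`!%:R = 'C(n.+1, i.+1)%:R * i.+1`!%:R * (n - i)`!%:R :> F.
  by rewrite -!natrM -mulnA -subSS bin_fact.
by rewrite H; field; rewrite !fact_neq0 nat1r pnatr_eq0.
Qed.

(** * Algebra of Cauchy products and the Euler operator *)

Section CauchyProd.
Variable F : comNzRingType.
Implicit Types u v w : nat -> F.

Lemma cauchy_prodC u v : cauchy_prod u v = cauchy_prod v u.
Proof.
apply/funext => n; rewrite /cauchy_prod (reindex_inj rev_ord_inj) /=.
by apply: eq_bigr => i _; rewrite subSS mulrC subKn // -ltnS.
Qed.

(** Truncation to polynomials lets associativity be inherited from [{poly F}]. *)
Lemma cauchy_prod_poly u v N n : (n < N)%N ->
  cauchy_prod u v n = ((\poly_(i < N) u i) * (\poly_(i < N) v i))`_n.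
Proof.
move=> nN; rewrite coefM; apply: eq_bigr => i _.
rewrite !coef_poly (leq_ltn_trans _ nN) ?(leq_ltn_trans _ nN) ?leq_subr//.
by rewrite -ltnS.
Qed.

Lemma cauchy_prodA u v w :
  cauchy_prod u (cauchy_prod v w) = cauchy_prod (cauchy_prod u v) w.
Proof.
apply/funext => n.
pose p s : {poly F} := \poly_(i < n.+1) s i.
transitivity ((p u * (p v * p w))`_n).
  rewrite coefM; apply: eq_bigr => i _.
  rewrite coef_poly ltn_ord; congr (_ * _).
  by rewrite (@cauchy_prod_poly _ _ n.+1)// ltnS leq_subr.
rewrite mulrA coefM; apply: eq_bigr => i _.
rewrite coef_poly ltnS leq_subr; congr (_ * _).
by rewrite -(@cauchy_prod_poly _ _ n.+1).
Qed.

Lemma cauchy_prodDl u v w :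
  cauchy_prod (fun n => u n + v n) w =
  fun n => cauchy_prod u w n + cauchy_prod v w n.
Proof.
by apply/funext => n; rewrite -big_split; apply: eq_bigr => i _; rewrite mulrDl.
Qed.

Lemma cauchy_prodNl u w :
  cauchy_prod (fun n => - u n) w = fun n => - cauchy_prod u w n.
Proof.
by apply/funext => n; rewrite -sumrN; apply: eq_bigr => i _; rewrite mulNr.
Qed.

Lemma cauchy_prod1l u : cauchy_prod (fun n => (n == 0)%:R) u = u.
Proof.
apply/funext => n; rewrite /cauchy_prod big_ord_recl /= mul1r subn0.
by rewrite big1 ?addr0 // => i _; rewrite mul0r.
Qed.

(** Leibniz rule for theta: on each summand the weight [n] splits as [i + (n - i)]. *)
Lemma euler_cauchy_prod u v n :
  n%:R * cauchy_prod u v n =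
  cauchy_prod (fun i => i%:R * u i) v n + cauchy_prod u (fun i => i%:R * v i) n.
Proof.
rewrite -big_split mulr_sumr; apply: eq_bigr => i _ /=.
have {1}-> : n = (i + (n - i))%N by rewrite subnKC // -ltnS.
by rewrite natrD; ring.
Qed.

Lemma cauchy_prod_scale (x : F) u v n :
  cauchy_prod (fun i => u i * x ^+ i) (fun i => v i * x ^+ i) n =
  cauchy_prod u v n * x ^+ n.
Proof.
rewrite /cauchy_prod mulr_suml; apply: eq_bigr => i _.
have e : x ^+ n = x ^+ i * x ^+ (n - i) by rewrite -exprD subnKC // -ltnS.
by rewrite e; ring.
Qed.

Lemma cauchy_prodBl u v w :
  cauchy_prod (fun n => u n - v n) w = fun n => cauchy_prod u w n - cauchy_prod v w n.
Proof. by rewrite cauchy_prodDl cauchy_prodNl. Qed.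

Lemma cauchy_prodBr u v w :
  cauchy_prod u (fun n => v n - w n) = fun n => cauchy_prod u v n - cauchy_prod u w n.
Proof. by rewrite cauchy_prodC cauchy_prodBl !(cauchy_prodC u). Qed.

Lemma cauchy_prod_shift u v n : v 0 = 0 ->
  cauchy_prod u (fun m => v m.+1) n = cauchy_prod u v n.+1.
Proof.
move=> v0; rewrite /cauchy_prod [RHS]big_ord_recr /= subnn v0 mulr0 addr0.
by apply: eq_bigr => i _; rewrite subSn // -ltnS.
Qed.

Lemma cauchy_prodMr u v (a : F) n :
  cauchy_prod u (fun m => a * v m) n = a * cauchy_prod u v n.
Proof. by rewrite mulr_sumr; apply: eq_bigr => i _; rewrite mulrCA. Qed.

End CauchyProd.

(** * Real-valued modulus and convergence by components *)

Section ComplexModulus.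
Variable R : realType.
Local Notation C := (Cplx R).
Implicit Types z w : C.

(** The norm of [Cplx R] takes values in [Cplx R]; its real part is used so that estimates take
    place in [R]. *)
Definition cmod z : R := complex.Re `|z|.

Lemma cmodE z : `|z| = (cmod z)%:C%C :> C.
Proof. by []. Qed.

Lemma cmod_ge0 z : 0 <= cmod z.
Proof. by rewrite -ler0c -cmodE normr_ge0. Qed.

Lemma cmodM z w : cmod (z * w) = cmod z * cmod w.
Proof. by apply: complexI; rewrite rmorphM -!cmodE normrM. Qed.

Lemma cmodX z n : cmod (z ^+ n) = cmod z ^+ n.
Proof. by apply: complexI; rewrite rmorphXn -!cmodE normrX. Qed.

Lemma cmodD z w : cmod (z + w) <= cmod z + cmod w.
Proof. by rewrite -lecR rmorphD -!cmodE ler_normD. Qed.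

Lemma cmodN z : cmod (- z) = cmod z.
Proof. by apply: complexI; rewrite -!cmodE normrN. Qed.

Lemma cmodB z w : cmod (z - w) <= cmod z + cmod w.
Proof. by rewrite -(cmodN w) cmodD. Qed.

Lemma cmod_distrC z w : cmod (z - w) = cmod (w - z).
Proof. by rewrite -cmodN opprB. Qed.

Lemma cmod_real (x : R) : cmod (x%:C%C : C) = `|x|.
Proof. by rewrite /cmod normc_def /= expr0n /= addr0 sqrtr_sqr. Qed.

Lemma cmod_nat n : cmod n%:R = n%:R.
Proof. by rewrite -(rmorph_nat (real_complex R)) cmod_real normr_nat. Qed.

Lemma cmod_divn z n : cmod (z / n%:R) = cmod z / n%:R.
Proof.
rewrite -(rmorph_nat (real_complex R)) -fmorphV cmodM cmod_real.
by rewrite ger0_norm ?invr_ge0.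
Qed.

Lemma cmod_divn_le z n : cmod (z / n%:R) <= cmod z.
Proof.
rewrite cmod_divn ler_piMr ?cmod_ge0//.
by case: n => [|n]; rewrite ?invr0// invf_le1// ler1n.
Qed.

Lemma cmod0 : cmod 0 = 0.
Proof. by rewrite (cmod_nat 0). Qed.

Lemma cmod_sum (I : Type) (s : seq I) (P : pred I) (F : I -> C) :
  cmod (\sum_(i <- s | P i) F i) <= \sum_(i <- s | P i) cmod (F i).
Proof.
elim/big_ind2: _ => [|z x w y zx wy|i _]; rewrite ?cmod0//.
by rewrite (le_trans (cmodD _ _))// lerD.
Qed.

Lemma Re_le_cmod z : `|complex.Re z| <= cmod z.
Proof. by rewrite -lecR -cmodE normc_ge_Re. Qed.

Lemma Im_le_cmod z : `|complex.Im z| <= cmod z.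
Proof.
have := Re_le_cmod (z * 'i%C); rewrite ReiNIm normrN cmodM.
suff -> : cmod 'i%C = 1 by rewrite mulr1.
by rewrite /cmod normc_def /= expr0n /= expr1n add0r sqrtr1.
Qed.

Lemma cmod_le_ReIm z : cmod z <= `|complex.Re z| + `|complex.Im z|.
Proof.
rewrite {1}[z]complexE (le_trans (cmodD _ _))// cmodM !cmod_real lerD2l.
suff -> : cmod 'i%C = 1 by rewrite mul1r.
by rewrite /cmod normc_def /= expr0n /= expr1n add0r sqrtr1.
Qed.

Lemma gt0_real_complex (e : C) : 0 < e -> exists2 d : R, 0 < d & e = d%:C%C.
Proof.
by case: e => a b; rewrite ltcE /= => /andP[/eqP -> a0]; exists a.
Qed.

Lemma cplx_ReD z w : complex.Re (z + w) = complex.Re z + complex.Re w.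
Proof. by case: z w => [? ?] []. Qed.

Lemma cplx_ImD z w : complex.Im (z + w) = complex.Im z + complex.Im w.
Proof. by case: z w => [? ?] []. Qed.

Lemma cplx_ReB z w : complex.Re (z - w) = complex.Re z - complex.Re w.
Proof. by case: z w => [? ?] []. Qed.

Lemma cplx_ImB z w : complex.Im (z - w) = complex.Im z - complex.Im w.
Proof. by case: z w => [? ?] []. Qed.

Lemma Re_sum (I : Type) (s : seq I) (P : pred I) (F : I -> C) :
  complex.Re (\sum_(i <- s | P i) F i) = \sum_(i <- s | P i) complex.Re (F i).
Proof. by rewrite (big_morph (@complex.Re R : C -> R) (id1 := 0) (id2 := 0) cplx_ReD). Qed.

Lemma Im_sum (I : Type) (s : seq I) (P : pred I) (F : I -> C) :
  complex.Im (\sum_(i <- s | P i) F i) = \sum_(i <- s | P i) complex.Im (F i).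
Proof. by rewrite (big_morph (@complex.Im R : C -> R) (id1 := 0) (id2 := 0) cplx_ImD). Qed.

(** A positive element of [Cplx R] is a positive real, so real [e] suffice. *)
Lemma cplx_cvgP (T : Type) (F : set_system T) {FF : Filter F} (f : T -> C) (l : C) :
  f @ F --> l <-> forall e : R, 0 < e -> \forall t \near F, cmod (l - f t) < e.
Proof.
split=> [/cvgrPdist_lt fl e e0|fl].
  have /fl : 0 < e%:C%C :> C by rewrite ltcR.
  by apply: filterS => t; rewrite cmodE ltcR.
apply/cvgrPdist_lt => e /gt0_real_complex[d d0 ->].
by have := fl d d0; apply: filterS => t; rewrite cmodE ltcR.
Qed.

Lemma cvg_Re (T : Type) (F : set_system T) {FF : Filter F} (f : T -> C) (l : C) :
  f @ F --> l -> complex.Re (f t) @[t --> F] --> complex.Re l.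
Proof.
move=> /cplx_cvgP fl; apply/cvgrPdist_lt => e e0.
apply: filterS (fl e e0) => t; apply: le_lt_trans.
by rewrite -cplx_ReB Re_le_cmod.
Qed.

Lemma cvg_Im (T : Type) (F : set_system T) {FF : Filter F} (f : T -> C) (l : C) :
  f @ F --> l -> complex.Im (f t) @[t --> F] --> complex.Im l.
Proof.
move=> /cplx_cvgP fl; apply/cvgrPdist_lt => e e0.
apply: filterS (fl e e0) => t; apply: le_lt_trans.
by rewrite -cplx_ImB Im_le_cmod.
Qed.

Lemma cvg_Complex (T : Type) (F : set_system T) {FF : Filter F} (f : T -> C) (a b : R) :
  complex.Re (f t) @[t --> F] --> a -> complex.Im (f t) @[t --> F] --> b ->
  f @ F --> (Complex a b : C).
Proof.
move=> /cvgrPdist_lt fa /cvgrPdist_lt fb; apply/cplx_cvgP => e e0.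
have e2 : 0 < e / 2 by rewrite divr_gt0.
apply: filterS (filterI (fa _ e2) (fb _ e2)) => t [ta tb].
apply: le_lt_trans (cmod_le_ReIm _) _.
by rewrite (splitr e) ltrD // (cplx_ReB, cplx_ImB).
Qed.

End ComplexModulus.

(** * Geometrically dominated series: convergence, tails and products *)

Section GeometricSeries.
Variable R : realType.
Local Notation C := (Cplx R).
Implicit Types (u v : nat -> C) (c r : R).

Definition geo_bound c r u := forall n, cmod (u n) <= c * r ^+ n.

Lemma geo_bound_ge0 c r u : geo_bound c r u -> 0 <= c.
Proof. by move=> /(_ 0); rewrite expr0 mulr1; apply: le_trans (cmod_ge0 _). Qed.

Lemma geo_block c r u (N m : nat) : 0 <= r < 1 -> geo_bound c r u ->
  \sum_(N <= i < m) cmod (u i) <= c * r ^+ N / (1 - r).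
Proof.
move=> /andP[r0 r1] ub; have c0 := geo_bound_ge0 ub.
have r1' : 0 < 1 - r by rewrite subr_gt0.
have [mN|Nm] := leqP m N.
  by rewrite big_geq// divr_ge0 ?(ltW r1')// mulr_ge0 ?exprn_ge0.
rewrite ler_pdivlMr//.
(* Since [(1 - r) r ^ i = r ^ i - r ^ i.+1], the bound telescopes. *)
apply: (@le_trans _ _ (\sum_(N <= i < m) (c * (r ^+ i - r ^+ i.+1)))).
  rewrite mulr_suml; apply: ler_sum => i _.
  rewrite (le_trans (ler_wpM2r (ltW r1') (ub i)))// exprS le_eqVlt.
  by apply/orP; left; apply/eqP; ring.
rewrite -mulr_sumr ler_wpM2l//.
under eq_bigr do rewrite -opprB.
by rewrite sumrN telescope_sumr ?(ltnW Nm)// opprB gerBl exprn_ge0.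
Qed.

Lemma geo_real_cvg (a : nat -> R) c r : 0 <= r < 1 ->
  (forall n, `|a n| <= c * r ^+ n) -> cvgn (series a).
Proof.
move=> /andP[r0 r1] ab; apply: normed_cvg.
apply: (@series_le_cvg _ _ (geometric c r)) => [n|n|n|] //=.
- by rewrite (le_trans _ (ab n)).
- by apply: is_cvg_geometric_series; rewrite ger0_norm.
Qed.

Lemma geo_cvg c r u : 0 <= r < 1 -> geo_bound c r u -> cvgn (series u).
Proof.
move=> r01 ub; apply: cvgP.
have ReE n : complex.Re (series u n) = series (fun i => complex.Re (u i)) n.
  exact: Re_sum.
have ImE n : complex.Im (series u n) = series (fun i => complex.Im (u i)) n.
  exact: Im_sum.
apply: cvg_Complex; under eq_fun do rewrite (ReE, ImE).
- apply: (@geo_real_cvg _ c r) => // n.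
  exact: le_trans (Re_le_cmod _) (ub n).
- apply: (@geo_real_cvg _ c r) => // n.
  exact: le_trans (Im_le_cmod _) (ub n).
Qed.

Lemma lim_series_Re u : cvgn (series u) ->
  complex.Re (limn (series u)) = limn (series (fun i => complex.Re (u i))).
Proof.
move=> /cvg_Re cu; apply/esym/cvg_lim => //.
by under [X in X @ _]eq_fun do rewrite -Re_sum.
Qed.

Lemma lim_series_Im u : cvgn (series u) ->
  complex.Im (limn (series u)) = limn (series (fun i => complex.Im (u i))).
Proof.
move=> /cvg_Im cu; apply/esym/cvg_lim => //.
by under [X in X @ _]eq_fun do rewrite -Im_sum.
Qed.

Lemma geo_tail c r u N : 0 <= r < 1 -> geo_bound c r u ->
  cmod (limn (series u) - series u N) <= c * r ^+ N / (1 - r).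
Proof.
move=> r01 ub; apply/ler_addgt0Pl => e e0.
have /cplx_cvgP/(_ e e0)[m _ /(_ (maxn m N) (leq_maxl _ _)) /= lm] := geo_cvg r01 ub.
rewrite -(subrKA (series u (maxn m N))).
rewrite (le_trans (cmodD _ _))// lerD ?(ltW lm)//.
rewrite sub_series_geq ?leq_maxr// (le_trans (cmod_sum _ _ _))//.
exact: geo_block.
Qed.

Lemma geo_tail_lt c r (e : R) : 0 <= r < 1 -> 0 < e ->
  exists N, c * r ^+ N / (1 - r) < e.
Proof.
move=> /andP[r0 r1] e0; have nr : `|r| < 1 by rewrite ger0_norm.
have /cvgrPdist_lt/(_ _ e0)[N _ /(_ N (leqnn N))] := cvg_geometric (c / (1 - r)) nr.
rewrite /= sub0r normrN mulrAC => H; exists N; apply: le_lt_trans H.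
exact: ler_norm.
Qed.

(** A Bernoulli estimate: moving the ratio to the midpoint [r + h] of [r] and 1 absorbs the factor
    [n], because [(1 + n h) r ^ n <= (r + h) ^ n]. *)
Lemma natmul_pow_le r (n : nat) : 0 <= r < 1 ->
  n%:R * r ^+ n <= (2 / (1 - r)) * ((1 + r) / 2) ^+ n.
Proof.
move=> /andP[r0 r1]; set s := (1 + r) / 2; set h := (1 - r) / 2.
have h0 : 0 < h by rewrite divr_gt0 ?subr_gt0.
have sE : s = r + h by rewrite /s /h; field.
suff H : (1 + n%:R * h) * r ^+ n <= s ^+ n.
  rewrite -[2 / _]invf_div -/h [leRHS]mulrC ler_pdivlMr//; apply: le_trans H.
  by rewrite mulrDl mul1r mulrAC lerDr exprn_ge0.
elim: n => [|n IH]; first by rewrite !expr0 mul0r addr0 mulr1.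
rewrite [s ^+ _]exprS; apply: le_trans (_ : s * ((1 + n%:R * h) * r ^+ n) <= _).
  rewrite exprS sE mulrA [leRHS]mulrA ler_wpM2r ?exprn_ge0//.
  rewrite -subr_ge0 -natr1.
  have -> : (r + h) * (1 + n%:R * h) - (1 + (n%:R + 1) * h) * r
     = h * (1 - r) + n%:R * h * h by ring.
  by rewrite addr_ge0 ?mulr_ge0 ?subr_ge0 // ltW.
by rewrite ler_wpM2l // sE addr_ge0 // ltW.
Qed.

Lemma midpoint1_itv r : 0 <= r < 1 -> 0 <= (1 + r) / 2 < 1.
Proof. by move=> /andP[? ?]; apply/andP; split; lra. Qed.

Lemma geo_bound_natmul c r u : 0 <= r < 1 -> geo_bound c r u ->
  geo_bound (c * (2 / (1 - r))) ((1 + r) / 2) (fun n => n%:R * u n).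
Proof.
move=> r01 ub n; have c0 := geo_bound_ge0 ub.
rewrite cmodM cmod_nat -mulrA.
apply: (@le_trans _ _ (c * (n%:R * r ^+ n))).
  by rewrite mulrCA ler_wpM2l.
by rewrite ler_wpM2l// natmul_pow_le.
Qed.

Lemma series_cauchy_prod u v N :
  series (cauchy_prod u v) N = \sum_(0 <= i < N) u i * series v (N - i)%N.
Proof.
rewrite /series /=; elim: N => [|N IH]; first by rewrite !big_nil.
rewrite big_nat_recr//= IH big_nat_recr//= subSnn big_nat1.
rewrite /cauchy_prod -(big_mkord xpredT (fun i => u i * v (N - i)%N)).
rewrite big_nat_recr//= subnn addrA -big_split /=; congr (_ + _).
apply: eq_big_nat => i /andP[_ iN].
by rewrite subSn ?(ltnW iN)// big_nat_recr//= mulrDr.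
Qed.

(** The error at [N] is the sum over [i < N] of [u i] times the tail of [v] from [N - i]. Each of
    the [N] summands is at most a constant times [r ^ N], and [N r ^ N] tends to 0. *)
Lemma cauchy_prod_cvg c r u v : 0 <= r < 1 -> geo_bound c r u -> geo_bound c r v ->
  series (cauchy_prod u v) n @[n --> \oo] --> limn (series u) * limn (series v).
Proof.
move=> r01 ub vb; have c0 := geo_bound_ge0 ub.
have r1 : 0 < 1 - r by case/andP: r01; rewrite subr_gt0.
have h2 : series u n * limn (series v) @[n --> \oo] -->
    limn (series u) * limn (series v).
  by apply: cvgM; [exact: geo_cvg r01 ub | exact: cvg_cst].
suff h1 : series u N * limn (series v) - series (cauchy_prod u v) N @[N --> \oo] --> (0 : C).
  have -> : series (cauchy_prod u v) = (fun n => series u n * limn (series v)) \-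
      (fun n => series u n * limn (series v) - series (cauchy_prod u v) n).
    by apply/funext => n /=; rewrite subKr.
  have -> : limn (series u) * limn (series v) = limn (series u) * limn (series v) - 0.
    by rewrite subr0.
  exact: (cvgB h2 h1).
pose K := c * (c / (1 - r)) * (2 / (1 - r)).
pose s := (1 + r) / 2.
have bnd N : cmod (series u N * limn (series v) - series (cauchy_prod u v) N)
    <= geometric K s N.
  rewrite series_cauchy_prod {1}/series /= mulr_suml -sumrB.
  apply: le_trans (cmod_sum _ _ _) _.
  apply: (@le_trans _ _ (\sum_(0 <= i < N) (c * (c / (1 - r)) * r ^+ N))).
    apply: ler_sum_nat => i /andP[_ iN].
    rewrite -mulrBr cmodM.
    have -> : c * (c / (1 - r)) * r ^+ N = (c * r ^+ i) * (c * r ^+ (N - i) / (1 - r)).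
      by rewrite -{1}(subnKC (ltnW iN)) exprD; field; rewrite gt_eqF.
    by rewrite ler_pM ?cmod_ge0 ?geo_tail.
  rewrite sumr_const_nat subn0 -mulr_natl mulrCA /= /K -[leRHS]mulrA ler_wpM2l //.
    by rewrite mulr_ge0 // divr_ge0 // ltW.
  exact: natmul_pow_le.
have s01 : `|s| < 1 by case/andP: (midpoint1_itv r01) => ? ?; rewrite ger0_norm.
apply/cplx_cvgP => e e0.
have /cvgrPdist_lt/(_ e e0) H := cvg_geometric K s01.
apply: filterS H => N /=; rewrite !sub0r cmodN normrN; apply: le_lt_trans.
by rewrite (le_trans (bnd N)) // ler_norm.
Qed.

End GeometricSeries.

(** * The complex exponential and derivatives of curves in the plane *)

Section ComplexCurves.
Variable R : realType.
Local Notation C := (Cplx R).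
Implicit Types (f g : R -> C) (x : R) (d : C).

Lemma cplx_ReM (z w : C) :
  complex.Re (z * w) = complex.Re z * complex.Re w - complex.Im z * complex.Im w.
Proof. by case: z w => [? ?] []. Qed.

Lemma cplx_ImM (z w : C) :
  complex.Im (z * w) = complex.Re z * complex.Im w + complex.Im z * complex.Re w.
Proof. by case: z w => [? ?] []. Qed.

Lemma cplx_eq (z w : C) :
  complex.Re z = complex.Re w -> complex.Im z = complex.Im w -> z = w.
Proof. by case: z w => [? ?] [? ?] /= -> ->. Qed.

Lemma cexpD (z w : C) : cexp (z + w) = cexp z * cexp w.
Proof.
apply: cplx_eq; rewrite ?cplx_ReM ?cplx_ImM /= cplx_ReD cplx_ImD expRD.
  by rewrite cosD; ring.
by rewrite sinD; ring.
Qed.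

Lemma cexp0 : cexp (0 : C) = 1.
Proof. by apply: cplx_eq; rewrite /= expR0 ?cos0 ?sin0 mul1r. Qed.

Lemma cexpN_mul (z : C) : cexp (- z) * cexp z = 1.
Proof. by rewrite -cexpD addNr cexp0. Qed.

Lemma cexpMn (z : C) n : cexp (n%:R * z) = cexp z ^+ n.
Proof.
elim: n => [|n IH]; first by rewrite mul0r cexp0.
by rewrite -natr1 mulrDl mul1r cexpD IH exprSr.
Qed.

Lemma cexp_real (x : R) : cexp (x%:C%C : C) = (expR x)%:C%C.
Proof. by apply: cplx_eq; rewrite /= ?cos0 ?sin0 ?mulr1 ?mulr0. Qed.

(** The derivative is taken by components so that the real differentiation rules apply. *)
Definition is_cderive f x d :=
  is_derive x 1 (fun s => complex.Re (f s)) (complex.Re d) /\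
  is_derive x 1 (fun s => complex.Im (f s)) (complex.Im d).

Lemma is_cderiveN f x d : is_cderive f x d -> is_cderive (fun s => - f s) x (- d).
Proof.
have ReN (z : C) : complex.Re (- z) = - complex.Re z by case: z.
have ImN (z : C) : complex.Im (- z) = - complex.Im z by case: z.
move=> [fr fi]; split.
- by under eq_fun do rewrite ReN; rewrite ReN; apply: is_deriveN.
- by under eq_fun do rewrite ImN; rewrite ImN; apply: is_deriveN.
Qed.

Lemma is_cderiveM f g x d e : is_cderive f x d -> is_cderive g x e ->
  is_cderive (fun s => f s * g s) x (d * g x + f x * e).
Proof.
move=> [fr fi] [gr gi]; split.
- have -> : (fun s => complex.Re (f s * g s)) =
      (fun s => complex.Re (f s)) * (fun s => complex.Re (g s)) -
      (fun s => complex.Im (f s)) * (fun s => complex.Im (g s)).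
    by apply/funext => s; rewrite cplx_ReM.
  apply: is_derive_eq; rewrite cplx_ReD !cplx_ReM /GRing.scale /=; ring.
- have -> : (fun s => complex.Im (f s * g s)) =
      (fun s => complex.Re (f s)) * (fun s => complex.Im (g s)) +
      (fun s => complex.Im (f s)) * (fun s => complex.Re (g s)).
    by apply/funext => s; rewrite cplx_ImM.
  apply: is_derive_eq; rewrite cplx_ImD !cplx_ImM /GRing.scale /=; ring.
Qed.

Lemma is_cderive_cexp f x d : is_cderive f x d ->
  is_cderive (fun s => cexp (f s)) x (d * cexp (f x)).
Proof.
move=> [fr fi].
have de := is_derive1_comp (is_derive_expR (complex.Re (f x))) fr.
have dc := is_derive1_comp (is_derive_cos (complex.Im (f x))) fi.
have ds := is_derive1_comp (is_derive_sin (complex.Im (f x))) fi.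
split.
- apply: (is_derive_eq (is_deriveM de dc)).
  rewrite cplx_ReM /GRing.scale /=; ring.
- apply: (is_derive_eq (is_deriveM de ds)).
  rewrite cplx_ImM /GRing.scale /=; ring.
Qed.

(** The mean value theorem has no complex-valued form, so it is applied to the real and imaginary
    parts separately. *)
Lemma cderive0_const f : (forall x, x \in `[0, 1] -> is_cderive f x 0) -> f 1 = f 0.
Proof.
move=> f0.
have cst (h : R -> R) : (forall x, x \in `[0, 1] -> is_derive x 1 h 0) -> h 1 = h 0.
  move=> h0.
  have hd (x : R) : x \in `]0, 1[ -> is_derive x 1 h 0.
    by move=> xI; apply: h0; apply: subset_itv_oo_cc xI.
  have hc : {within `[0, 1], continuous h}.
    by apply: derivable_within_continuous => x /h0 [].
  have [c _ /eqP] := MVT_segment ler01 hd hc.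
  by rewrite mul0r subr_eq0 => /eqP.
by apply: cplx_eq; [apply: (cst (fun s => complex.Re (f s))) |
                    apply: (cst (fun s => complex.Im (f s)))] => x /f0 [].
Qed.

End ComplexCurves.

(** * Power series on a segment and the exponential differential equation *)

Section PowerSeriesRays.
Variable R : realType.
Local Notation C := (Cplx R).
Implicit Types (u v : nat -> C) (c r s : R).

Lemma geo_real_cvg_pseries (a : nat -> R) c r K : 0 <= r -> 0 <= K -> r * K < 1 ->
  (forall n, `|a n| <= c * r ^+ n) -> cvgn (pseries a K).
Proof.
move=> r0 K0 rK ab; apply: (@geo_real_cvg _ _ c (r * K)).
  by rewrite mulr_ge0.
by move=> n; rewrite normrM normrX (ger0_norm K0) exprMn mulrA ler_wpM2r ?exprn_ge0.
Qed.

Lemma pseries_diffs_bound (a : nat -> R) c r : 0 <= r < 1 ->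
  (forall n, `|a n| <= c * r ^+ n) ->
  forall n, `|pseries_diffs a n| <= c * (2 / (1 - r)) * ((1 + r) / 2) ^+ n.
Proof.
move=> r01 ab n.
have c0 : 0 <= c by have := ab 0; rewrite expr0 mulr1; apply: le_trans.
have r1 : 0 < 1 - r by case/andP: r01; rewrite subr_gt0.
have /andP[s0 s1] := midpoint1_itv r01.
rewrite /pseries_diffs normrM normr_nat.
apply: (@le_trans _ _ (c * (n.+1%:R * r ^+ n.+1))).
  by rewrite mulrCA ler_wpM2l.
rewrite -mulrA ler_wpM2l//; apply: le_trans (natmul_pow_le _ r01) _.
rewrite ler_wpM2l ?divr_ge0 ?(ltW r1)// exprS ler_piMl ?exprn_ge0// ltW//.
Qed.

Lemma is_derive_pseries (a : nat -> R) c r s : 0 <= r < 1 ->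
  (forall n, `|a n| <= c * r ^+ n) -> 0 <= s <= 1 ->
  is_derive s 1 (fun x => limn (pseries a x)) (limn (pseries (pseries_diffs a) s)).
Proof.
move=> r01 ab /andP[s0 s1].
have r01' := midpoint1_itv r01; have r01'' := midpoint1_itv r01'.
have ab' := pseries_diffs_bound r01 ab.
have ab'' := pseries_diffs_bound r01' ab'.
move: r01' r01'' ab' ab''; set r' := (1 + r) / 2; set r'' := (1 + r') / 2.
move=> /andP[p1 p2] /andP[q1 q2] ab' ab''; case/andP: r01 => r0 r1.
(* [pseries_snd_diffs] asks for a point [K] beyond [s] where the series and its first two formal
   derivatives converge. Each derivative moves the ratio to the next midpoint, and this [K]
   satisfies [1 < K] and [r'' K < 1]. *)
pose K := 2 / (1 + r'').
have K0 : 0 <= K by rewrite divr_ge0 // addr_ge0.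
have K1 : 1 < K by rewrite ltr_pdivlMr; lra.
have rK3 : r'' * K < 1 by rewrite /K mulrA ltr_pdivrMr; lra.
have rK2 : r' * K < 1 by apply: le_lt_trans rK3; rewrite ler_wpM2r// /r''; lra.
have rK1 : r * K < 1 by apply: le_lt_trans rK2; rewrite ler_wpM2r// /r'; lra.
apply: (@pseries_snd_diffs _ _ K).
- exact: geo_real_cvg_pseries rK1 ab.
- exact: geo_real_cvg_pseries rK2 ab'.
- exact: geo_real_cvg_pseries rK3 ab''.
- by rewrite !ger0_norm// (le_lt_trans s1).
Qed.

(** The sum of [u n * s ^ n], encoded by components so that real power series can be differentiated.
    When [u n] contains [x ^ n], it is the function on the segment from 0 to [x]. *)
Definition ray u s : C :=
  Complex (limn (pseries (fun n => complex.Re (u n)) s))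
          (limn (pseries (fun n => complex.Im (u n)) s)).

Definition cdiffs u n : C := n.+1%:R * u n.+1.

Lemma cmod_ray_term c r u s : 0 <= s <= 1 -> geo_bound c r u ->
  geo_bound c r (fun n => u n * (s%:C%C) ^+ n).
Proof.
move=> /andP[s0 s1] ub n; rewrite cmodM cmodX cmod_real ger0_norm//.
by rewrite (le_trans _ (ub n))// ler_piMr ?cmod_ge0// exprn_ile1.
Qed.

Lemma rcX s n : (s%:C%C : C) ^+ n = (s ^+ n)%:C%C.
Proof. by rewrite rmorphXn. Qed.

Lemma ray_cvg c r u s : 0 <= r < 1 -> 0 <= s <= 1 -> geo_bound c r u ->
  cvgn (series (fun n => u n * (s%:C%C) ^+ n)).
Proof. by move=> r01 s01 /(cmod_ray_term s01); apply: geo_cvg. Qed.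

Lemma rayE c r u s : 0 <= r < 1 -> 0 <= s <= 1 -> geo_bound c r u ->
  ray u s = limn (series (fun n => u n * (s%:C%C) ^+ n)).
Proof.
move=> r01 s01 ub; have cu := ray_cvg r01 s01 ub.
apply: cplx_eq; rewrite ?(lim_series_Re cu) ?(lim_series_Im cu) /=;
  congr (limn (series _)); apply/funext => n; rewrite rcX.
- by rewrite cplx_ReM /= mulr0 subr0.
- by rewrite cplx_ImM /= mulr0 add0r.
Qed.

Lemma geo_bound_cdiffs c r u : 0 <= r < 1 -> geo_bound c r u ->
  geo_bound (c * (2 / (1 - r))) ((1 + r) / 2) (cdiffs u).
Proof.
move=> r01 ub n; have c0 := geo_bound_ge0 ub.
have r1 : 0 < 1 - r by case/andP: r01; rewrite subr_gt0.
have /andP[s0 s1] := midpoint1_itv r01.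
apply: (le_trans (geo_bound_natmul r01 ub n.+1)).
rewrite ler_wpM2l ?mulr_ge0 ?invr_ge0 ?(ltW r1)//.
by rewrite exprS ler_piMl ?exprn_ge0 ?(ltW s1).
Qed.

Lemma geo_bound_le c c' r r' u : 0 <= c <= c' -> 0 <= r <= r' ->
  geo_bound c r u -> geo_bound c' r' u.
Proof.
move=> /andP[c0 cc] /andP[r0 rr] ub n; apply: le_trans (ub n) _.
by rewrite ler_pM ?exprn_ge0// lerXn2r// nnegrE (le_trans r0).
Qed.

Lemma is_cderive_ray c r u s : 0 <= r < 1 -> geo_bound c r u -> 0 <= s <= 1 ->
  is_cderive (ray u) s (ray (cdiffs u) s).
Proof.
move=> r01 ub s01.
have natRe n (z : C) : complex.Re (n%:R * z) = n%:R * complex.Re z.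
  by rewrite -(rmorph_nat (real_complex R)) cplx_ReM /= mul0r subr0.
have natIm n (z : C) : complex.Im (n%:R * z) = n%:R * complex.Im z.
  by rewrite -(rmorph_nat (real_complex R)) cplx_ImM /= mul0r addr0.
split => /=.
- under [X in limn (pseries X _)]eq_fun do rewrite natRe.
  apply: (@is_derive_pseries _ c r) => // n; exact: le_trans (Re_le_cmod _) (ub n).
- under [X in limn (pseries X _)]eq_fun do rewrite natIm.
  apply: (@is_derive_pseries _ c r) => // n; exact: le_trans (Im_le_cmod _) (ub n).
Qed.

Lemma ray0 c r u : 0 <= r < 1 -> geo_bound c r u -> ray u 0 = u 0.
Proof.
move=> r01 ub; rewrite (rayE r01 _ ub) ?lexx ?ler01//.
apply/cvg_lim => //; rewrite -cvg_shiftS; apply: cvg_near_cst.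
near=> n; rewrite /= /series /= big_nat_recl// expr0 mulr1 big1_seq ?addr0// => i _.
by rewrite rcX expr0n mulr0.
Unshelve. all: by end_near. Qed.

Lemma ray1 c r u : 0 <= r < 1 -> geo_bound c r u -> ray u 1 = limn (series u).
Proof.
move=> r01 ub; rewrite (rayE r01 _ ub) ?lexx ?ler01//.
by congr (limn (series _)); apply/funext => n; rewrite rcX expr1n mulr1.
Qed.

Lemma ray_cauchy_prod c r u v s : 0 <= r < 1 -> geo_bound c r u -> geo_bound c r v ->
  0 <= s <= 1 -> (exists c' r', 0 <= r' < 1 /\ geo_bound c' r' (cauchy_prod u v)) ->
  ray (cauchy_prod u v) s = ray u s * ray v s.
Proof.
move=> r01 ub vb s01 [c' [r' [r01' uvb]]].
rewrite (rayE r01 s01 ub) (rayE r01 s01 vb) (rayE r01' s01 uvb).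
have := cauchy_prod_cvg r01 (cmod_ray_term s01 ub) (cmod_ray_term s01 vb).
move=> /(cvg_lim (@norm_hausdorff _ _)) <-.
congr (limn (series _)); apply/funext => n.
by rewrite cauchy_prod_scale.
Qed.

(* Along each ray, [v] and [exp u] solve the same linear differential equation. *)
Lemma exp_series c r u v : 0 <= r < 1 -> geo_bound c r u -> geo_bound c r v ->
  v 0 = cexp (u 0) ->
  (forall n, n%:R * v n = cauchy_prod (fun k => k%:R * u k) v n) ->
  limn (series v) = cexp (limn (series u)).
Proof.
move=> r01 ub vb v0 uv; have c0 := geo_bound_ge0 ub.
(* The recursion in the form [v' = u' v]; the factor [k] kills the term [k = 0]. *)
have dv : cdiffs v = cauchy_prod (cdiffs u) v.
  apply/funext => n; rewrite /cdiffs uv /cauchy_prod big_ord_recl !mul0r add0r.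
  by apply: eq_bigr => i _; rewrite /bump /= ?add1n subSS.
pose c' := c * (2 / (1 - r)); pose r' := (1 + r) / 2.
have r01' : 0 <= r' < 1 := midpoint1_itv r01.
have du : geo_bound c' r' (cdiffs u) by apply: geo_bound_cdiffs.
have vb' : geo_bound c' r' v.
  apply: geo_bound_le vb; case/andP: r01 => r0 r1; apply/andP; split=> //.
    rewrite /c' ler_peMr// ler_pdivlMr ?subr_gt0//; lra.
  by rewrite /r'; lra.
(* On the segment, [v exp (- u)] has derivative [u' v exp (- u) - v u' exp (- u) = 0]. *)
have const : ray v 1 * cexp (- ray u 1) = ray v 0 * cexp (- ray u 0).
  apply: (@cderive0_const _ (fun s => ray v s * cexp (- ray u s))) => s sI.
  have s01 : 0 <= s <= 1 by move: sI; rewrite in_itv.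
  have hv := is_cderive_ray r01 vb s01.
  have hu := is_cderive_ray r01 ub s01.
  have := is_cderiveM hv (is_cderive_cexp (is_cderiveN hu)).
  rewrite dv (ray_cauchy_prod r01' du vb' s01); last first.
    (* The product [u' v] has a geometric bound because it equals [v']. *)
    by exists c', r'; split=> //; rewrite -dv; apply: geo_bound_cdiffs.
  by congr is_cderive; ring.
move: const; rewrite !(ray0 r01 ub, ray0 r01 vb, ray1 r01 ub, ray1 r01 vb).
rewrite v0 [RHS]mulrC cexpN_mul => e.
by rewrite -[LHS]mulr1 -(cexpN_mul (limn (series u))) mulrA e mul1r.
Qed.

End PowerSeriesRays.

(** * The series [z] and [t] on the unit disc *)

Section TreeSeries.
Variable R : realType.
Local Notation C := (Cplx R).
Implicit Types (x : C) (n : nat).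

(** Terms of [t], constant term included; [e ^ (- n)] is absorbed into [(x / e) ^ n] so that
    [cauchy_prod_scale] applies. *)
Definition tterm x n : C := tree_coef C n * (cexp (- 1) * x) ^+ n.

(* [zterm x 0 = 0] because [x / 0 = 0]; the same convention serves
   [disk_term] and [cyl_term]. *)
Definition zterm x n : C := tterm x n / n%:R.

(** [n ^ n / n!] is a single term of the exponential series at [n]. Hence the coefficients of [t] in
    [x] are at most 1, which gives convergence for [|x| < 1]. *)
Lemma tree_coef_le_expR n : tree_coef R n <= expR n%:R.
Proof.
case: n => [|n]; first by rewrite /tree_coef fact0 divr1 expR0.
rewrite /tree_coef natrX; apply: le_trans (expR_ge1Dxn n (ler0n _ n.+1)).
by rewrite lerDr.
Qed.

Lemma cmod_cexpN1 : cmod (cexp (- 1 : C)) = expR (- 1).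
Proof.
by rewrite -(rmorphN1 (real_complex R)) cexp_real cmod_real ger0_norm ?expR_ge0.
Qed.

Lemma tterm_bound x : geo_bound 1 (cmod x) (tterm x).
Proof.
move=> n; rewrite cmodM cmodX cmodM exprMn mulrA.
rewrite ler_wpM2r ?exprn_ge0 ?cmod_ge0// cmod_cexpN1.
have -> : cmod (tree_coef C n) = tree_coef R n.
  rewrite /tree_coef -!(rmorph_nat (real_complex R)) -fmorph_div cmod_real.
  by rewrite ger0_norm // divr_ge0.
rewrite -expRM_natl mulrN1 expRN.
by rewrite ler_pdivrMr ?expR_gt0// mul1r tree_coef_le_expR.
Qed.

Lemma zterm_bound x : geo_bound 1 (cmod x) (zterm x).
Proof.
by move=> n; apply: le_trans (tterm_bound x n); exact: cmod_divn_le.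
Qed.

Lemma tterm0 x : tterm x 0 = 1.
Proof. by rewrite /tterm /tree_coef expr0 fact0 divr1 mulr1. Qed.

Lemma zterm0 x : zterm x 0 = 0.
Proof. by rewrite /zterm invr0 mulr0. Qed.

Lemma euler_zterm x n : n%:R * zterm x n = tterm x n - (n == 0)%:R.
Proof.
case: n => [|n]; first by rewrite mul0r tterm0 subrr.
by rewrite subr0 /zterm mulrC divfK // pnatr_eq0.
Qed.

Lemma cauchy_zterm_tterm x :
  cauchy_prod (zterm x) (tterm x) = fun n => tterm x n - (n == 0)%:R.
Proof.
apply/funext => n; rewrite /tterm.
have -> : zterm x = fun i => tree_coef C i / i%:R * (cexp (- 1) * x) ^+ i.
  by apply/funext => i; rewrite /zterm /tterm mulrAC.
rewrite cauchy_prod_scale cauchy_prod_tree_coef mulrBl; congr (_ - _).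
by case: n => [|n]; rewrite ?expr0 ?mul1r ?mul0r.
Qed.

Lemma cvg_series_shift (u : nat -> C) (l : C) : series u @ \oo --> l ->
  series (fun n => u n.+1) @ \oo --> l - u 0.
Proof.
move=> cu.
have E n : series (fun n => u n.+1) n = series u n.+1 - u 0.
  by rewrite /series /= [in RHS]big_nat_recl// [u 0 + _]addrC addrK.
have h : series u n.+1 - u 0 @[n --> \oo] --> l - u 0.
  apply: cvgB; last exact: cvg_cst.
  by rewrite (cvg_shiftS (series u)).
by apply: cvg_trans h; apply: near_eq_cvg; near=> n; rewrite E.
Unshelve. all: by end_near. Qed.

Lemma cexpN_nat n : cexp (- n%:R : C) = cexp (- 1) ^+ n.
Proof. by rewrite -cexpMn mulrN1. Qed.

Lemma z_ofE x : z_of x = limn (series (zterm x)).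
Proof.
rewrite /z_of; congr (limn _); apply/funext => n; rewrite /series /=.
case: n => [|n]; first by rewrite !big_geq.
rewrite [RHS]big_ltn// zterm0 add0r; apply: eq_big_nat => m /andP[m0 _].
case: m m0 => // m _; rewrite cexpN_nat -mulrA -exprMn /zterm /tterm /tree_coef /=.
rewrite [in RHS]expnS [in RHS]natrM; field.
by rewrite fact_neq0 nat1r pnatr_eq0.
Qed.

Lemma cvg_zterm x : `|x| < 1 -> cvgn (series (zterm x)).
Proof.
rewrite cmodE -(rmorph1 (real_complex R)) ltcR => x1.
by apply: geo_cvg (zterm_bound x); rewrite cmod_ge0.
Qed.

Lemma cvg_tterm x : `|x| < 1 -> cvgn (series (tterm x)).
Proof.
rewrite cmodE -(rmorph1 (real_complex R)) ltcR => x1.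
by apply: geo_cvg (tterm_bound x); rewrite cmod_ge0.
Qed.

Lemma t_ofE x : `|x| < 1 -> t_of x = limn (series (tterm x)).
Proof.
move=> /cvg_tterm ct.
suff h : (fun n => \sum_(1 <= m < n)
    ((m ^ m)%:R / (m`!)%:R * cexp (- m%:R) * x ^+ m)) @ \oo --> limn (series (tterm x)) - 1.
  by rewrite /t_of (cvg_lim (@norm_hausdorff _ _) h) addrC subrK.
have h : series (tterm x) n - 1 @[n --> \oo] --> limn (series (tterm x)) - 1.
  exact: (cvgB ct (cvg_cst (1 : C))).
apply: cvg_trans h; apply: near_eq_cvg; near=> n.
have n0 : (0 < n)%N by near: n; exists 1%N.
rewrite /series /= [in LHS]big_ltn// tterm0 addrC addKr; apply: eq_big_nat => m _.
by rewrite cexpN_nat -mulrA -exprMn.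
Unshelve. all: by end_near. Qed.

Lemma cvg_seriesD (u v : nat -> C) (l m : C) :
  series u @ \oo --> l -> series v @ \oo --> m ->
  series (fun n => u n + v n) @ \oo --> l + m.
Proof.
move=> ul vm; have h : series u n + series v n @[n --> \oo] --> l + m by exact: (cvgD ul vm).
by apply: cvg_trans h; apply: near_eq_cvg; near=> n; rewrite /series /= big_split.
Unshelve. all: by end_near. Qed.

Lemma cvg_seriesMl (u : nat -> C) (c l : C) : series u @ \oo --> l ->
  series (fun n => c * u n) @ \oo --> c * l.
Proof.
move=> ul; have h : c * series u n @[n --> \oo] --> c * l.
  by apply: cvgM ul; exact: cvg_cst.
by apply: cvg_trans h; apply: near_eq_cvg; near=> n; rewrite /series /= mulr_sumr.
Unshelve. all: by end_near. Qed.

Lemma cvg_seriesB (u v : nat -> C) (l m : C) :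
  series u @ \oo --> l -> series v @ \oo --> m ->
  series (fun n => u n - v n) @ \oo --> l - m.
Proof.
move=> ul /(cvg_seriesMl (c := -1)); rewrite mulN1r => vm.
by have := cvg_seriesD ul vm; under [X in series X]eq_fun do rewrite mulN1r.
Qed.

Lemma cvg_series_delta : series (fun n => (n == 0)%:R : C) @ \oo --> (1 : C).
Proof.
rewrite -cvg_shiftS; apply: cvg_near_cst; near=> n.
by rewrite /= /series /= big_nat_recl// big1 ?addr0.
Unshelve. all: by end_near. Qed.

Lemma cvg_cauchy_zterm x (u : nat -> C) : `|x| < 1 -> geo_bound 1 (cmod x) u ->
  series (cauchy_prod (zterm x) u) @ \oo --> z_of x * limn (series u).
Proof.
rewrite cmodE -(rmorph1 (real_complex R)) ltcR z_ofE => x1 ub.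
by apply: cauchy_prod_cvg (zterm_bound x) ub; rewrite cmod_ge0.
Qed.

Lemma z_mul_t x : `|x| < 1 -> z_of x * t_of x = t_of x - 1.
Proof.
move=> x1; have h := cvg_cauchy_zterm x1 (tterm_bound x).
rewrite cauchy_zterm_tterm -t_ofE// in h.
have ct := cvg_tterm x1.
have h2 := cvg_seriesB ct cvg_series_delta; rewrite -t_ofE// in h2.
exact: (cvg_unique (@norm_hausdorff _ _) h h2).
Qed.

End TreeSeries.

(** * The relations between [x], [z] and [t] *)

Section LaplaceClosedForms.
Variable R : realType.
Local Notation C := (Cplx R).
Implicit Types (x y : C) (n : nat) (c r : R).

Lemma cmod_lt1 x : `|x| < 1 -> cmod x < 1.
Proof. by rewrite cmodE -(rmorph1 (real_complex R)) ltcR. Qed.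

(** At a zero of [t] the relation [z t = t - 1] would read [0 = - 1]. *)
Lemma t_of_neq0 x : `|x| < 1 -> t_of x != 0.
Proof.
move=> /z_mul_t; apply: contra_eq_neq => ->.
by rewrite mulr0 sub0r eq_sym oppr_eq0 oner_neq0.
Qed.

Lemma z_of_t x : `|x| < 1 -> z_of x = (t_of x - 1) / t_of x.
Proof. by move=> x1; rewrite -z_mul_t// mulfK// t_of_neq0. Qed.

(* If [theta w = u w] and [theta p = u - 1], then [w / x] and [exp p] satisfy
   the same first-order equation. *)
Lemma exp_series_shift c r (u p w : nat -> C) (a : C) :
  0 <= r < 1 -> geo_bound c r p -> geo_bound c r (fun n => a * w n.+1) ->
  w 0 = 0 -> a * w 1 = cexp (p 0) ->
  (forall n, n%:R * p n = u n - (n == 0)%:R) ->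
  (forall n, n%:R * w n = cauchy_prod u w n) ->
  cvgn (series w) ->
  a * limn (series w) = cexp (limn (series p)).
Proof.
move=> r01 pb wb w0 w1 pu uw cw.
rewrite -(exp_series r01 pb wb w1).
  have h := cvg_seriesMl (c := a) (cvg_series_shift cw).
  by rewrite w0 subr0 in h; rewrite (cvg_lim (@norm_hausdorff _ _) h).
(* Since [n w_(n+1) = (n + 1) w_(n+1) - w_(n+1)], the index shift turns [theta w] into
   [theta w - w]; this is the [- 1] in [theta p = u - 1]. *)
move=> n; rewrite (_ : (fun k => _) = fun k => u k - (k == 0)%:R); last exact/funext.
rewrite cauchy_prodBl cauchy_prod1l cauchy_prodMr cauchy_prod_shift// -uw.
by rewrite -natr1; ring.
Qed.

Lemma geo_bound_weaken c c' r (u : nat -> C) : 0 <= r -> c <= c' ->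
  geo_bound c r u -> geo_bound c' r u.
Proof.
by move=> r0 cc ub n; apply: le_trans (ub n) _; rewrite ler_wpM2r ?exprn_ge0.
Qed.

Lemma geo_bound_shift c r (a : C) (w : nat -> C) : 0 <= r ->
  geo_bound c r w -> geo_bound (cmod a * c * r) r (fun n => a * w n.+1).
Proof.
move=> r0 wb n; rewrite cmodM -!mulrA -exprS ler_wpM2l ?cmod_ge0//; exact: wb.
Qed.

Lemma zterm1 x : zterm x 1 = cexp (- 1) * x.
Proof. by rewrite /zterm /tterm /tree_coef !divr1 expr1 mul1r. Qed.

(** For [x != 0], [exp_series_shift] with [u = t] and [p = w = z] gives [e z / x = exp z]; its two
    hypotheses are [theta z = t - 1] and [theta z = t z]. *)
Lemma z_of_tree x : `|x| < 1 -> x = z_of x * cexp (1 - z_of x).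
Proof.
move=> x1; have [->|x0] := eqVneq x 0.
  have -> : z_of 0 = 0 :> C; last by rewrite mul0r.
  rewrite z_ofE; apply: (cvg_lim (@norm_hausdorff _ _)); apply: cvg_near_cst.
  near=> n; rewrite /series /= big1// => i _; rewrite /zterm /tterm mulr0.
  by case: i => [|i]; rewrite ?invr0 ?mulr0// expr0n mulr0 mul0r.
have x01 : 0 <= cmod x < 1 by rewrite cmod_ge0 cmod_lt1.
(* [a = e / x] makes the first coefficient of [a * z] equal to [exp 0 = 1]; [c] dominates the
   constants of both series. *)
pose a := cexp 1 / x; pose c := 1 + cmod a * 1 * cmod x.
have c1 : 1 <= c by rewrite lerDl !mulr_ge0 ?cmod_ge0.
have ac : cmod a * 1 * cmod x <= c by rewrite lerDr.
have x_ge0 := cmod_ge0 x.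
have e : cexp 1 * cexp (- 1) = 1 :> C by rewrite -cexpD subrr cexp0.
have : a * z_of x = cexp (z_of x).
  rewrite z_ofE.
  apply: (exp_series_shift (c := c) (r := cmod x) (u := tterm x)) => //.
  - exact: geo_bound_weaken x_ge0 c1 (zterm_bound x).
  - exact: geo_bound_weaken x_ge0 ac (geo_bound_shift _ x_ge0 (zterm_bound x)).
  - exact: zterm0.
  - rewrite zterm0 cexp0 zterm1 /a; rewrite -[RHS]e; field.
    exact: x0.
  - exact: euler_zterm.
  - by move=> n; rewrite cauchy_prodC cauchy_zterm_tterm euler_zterm.
  - exact: cvg_zterm.
rewrite /a cexpD => H.
have e2 : cexp (- z_of x) * cexp (z_of x) = 1 by exact: cexpN_mul.
rewrite -H in e2.
have -> : z_of x * (cexp 1 * cexp (- z_of x)) =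
  x * (cexp (- z_of x) * (cexp 1 / x * z_of x)) by field; exact: x0.
by rewrite e2 mulr1.
Unshelve. all: by end_near. Qed.

End LaplaceClosedForms.

(** * The graded series of [F_(0,1)] and [F_(0,2)] *)

Section UnstableSeries.
Variable R : realType.
Local Notation C := (Cplx R).
Implicit Types (x y : C) (n : nat) (c r : R).

(* The series of F_(0,1), graded by the degree [d]. *)
Definition disk_term x n : C := zterm x n / n%:R.

(** In positive degree apply theta: [theta (z ^ 2) / 2 = z (t - 1) = t - 1 - z], so
    [theta (z - z ^ 2 / 2) = z]. In degree 0 both sides vanish. *)
Lemma disk_termE x n :
  disk_term x n = zterm x n - 2^-1 * cauchy_prod (zterm x) (zterm x) n.
Proof.
case: n => [|n].
  by rewrite /disk_term /cauchy_prod big_ord1 zterm0 !mul0r mulr0 subr0.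
have n0 : n.+1%:R != 0 :> C by rewrite pnatr_eq0.
apply: (mulfI n0); rewrite /disk_term mulrCA divff// mulr1 mulrBr [n.+1%:R * (2^-1 * _)]mulrCA.
rewrite euler_cauchy_prod.
have -> : (fun i => i%:R * zterm x i) = fun i => tterm x i - (i == 0)%:R.
  by apply/funext => i; rewrite euler_zterm.
rewrite [cauchy_prod (fun i => tterm x i - _) _]cauchy_prodC.
rewrite cauchy_prodBr cauchy_zterm_tterm euler_zterm.
rewrite [cauchy_prod _ (fun i => (i == 0)%:R)]cauchy_prodC cauchy_prod1l /=.
by field.
Qed.

Lemma cvg_disk x : `|x| < 1 ->
  series (disk_term x) @ \oo --> 1 / 2 * (1 - 1 / t_of x ^+ 2).
Proof.
move=> x1; have t0 := t_of_neq0 x1.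
(* As [1 / t = 1 - z], the left side is [(1 - (1 - z) ^ 2) / 2]. *)
have -> : 1 / 2 * (1 - 1 / t_of x ^+ 2) = z_of x - 2^-1 * (z_of x * z_of x).
  by rewrite (z_of_t x1); field.
have h := cvg_cauchy_zterm x1 (zterm_bound x); rewrite -z_ofE in h.
have h2 := cvg_zterm x1; rewrite -z_ofE in h2.
have -> : disk_term x = fun n => zterm x n - 2^-1 * cauchy_prod (zterm x) (zterm x) n.
  by apply/funext => n; rewrite disk_termE.
exact: cvg_seriesB h2 (cvg_seriesMl (c := 2^-1) h).
Qed.

(** The series [t - 1]: without the constant term, a product of two such series involves only
    positive parts. *)
Definition pterm x n : C := tterm x n - (n == 0)%:R.

(* The series of F_(0,2), graded by the degree [a + b]. *)
Definition cyl_term x y n : C := cauchy_prod (pterm x) (pterm y) n / n%:R.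

(** The series [P]. Its constant term [- 1] is the logarithm of [1 / e], the first coefficient of
    [z]. *)
Definition log_term x y n : C := cyl_term x y n + zterm x n + zterm y n - (n == 0)%:R.

(** [(t1 - 1) (t2 - 1) + (t1 - 1) + (t2 - 1) = t1 t2 - 1]. *)
Lemma euler_log_term x y n :
  n%:R * log_term x y n = cauchy_prod (tterm x) (tterm y) n - (n == 0)%:R.
Proof.
have e : n%:R * cyl_term x y n = cauchy_prod (pterm x) (pterm y) n.
  case: n => [|n]; last by rewrite /cyl_term mulrC divfK ?pnatr_eq0.
  by rewrite mul0r /cauchy_prod big_ord1 /pterm !tterm0 subrr mul0r.
rewrite /log_term mulrBr !mulrDr e !euler_zterm /pterm.
rewrite cauchy_prodBl !cauchy_prodBr cauchy_prod1l.
rewrite [cauchy_prod _ (fun i => (i == 0)%:R)]cauchy_prodC cauchy_prod1l.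
rewrite cauchy_prod1l.
by case: n {e} => [|n] /=; ring.
Qed.

Lemma tterm_bound_le x r : cmod x <= r -> geo_bound 1 r (tterm x).
Proof. by move=> xr; apply: geo_bound_le (tterm_bound x); rewrite ?cmod_ge0 ?ler01 ?lexx. Qed.

Lemma zterm_bound_le x r : cmod x <= r -> geo_bound 1 r (zterm x).
Proof. by move=> xr; apply: geo_bound_le (zterm_bound x); rewrite ?cmod_ge0 ?ler01 ?lexx. Qed.

Lemma pterm_bound x r : cmod x <= r -> geo_bound 1 r (pterm x).
Proof.
move=> xr [|n]; first by rewrite /pterm tterm0 subrr cmod0 expr0 mulr1.
by rewrite /pterm subr0; apply: tterm_bound_le.
Qed.

Lemma cauchy_prod_bound r (u v : nat -> C) n :
  geo_bound 1 r u -> geo_bound 1 r v ->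
  cmod (cauchy_prod u v n) <= n.+1%:R * r ^+ n.
Proof.
move=> ub vb; apply: le_trans (cmod_sum _ _ _) _.
apply: (@le_trans _ _ (\sum_(i < n.+1) r ^+ n)); last first.
  by rewrite sumr_const card_ord mulr_natl.
apply: ler_sum => i _; rewrite cmodM.
have in_ : (i <= n)%N by rewrite -ltnS.
rewrite -[X in r ^+ X](subnKC in_) exprD ler_pM ?cmod_ge0//.
  by rewrite -[leRHS]mul1r.
by rewrite -[leRHS]mul1r.
Qed.

(** Division by the degree compensates for the [n + 1] summands of a Cauchy product, since
    [(n + 1) / n <= 2]. *)
Lemma natmul_div_bound (a : C) r n : 0 <= r -> a = 0 \/ (0 < n)%N ->
  cmod a <= n.+1%:R * r ^+ n -> cmod (a / n%:R) <= 2 * r ^+ n.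
Proof.
move=> r0 [->|n0] ab; first by rewrite mul0r cmod0 mulr_ge0 ?exprn_ge0.
rewrite cmod_divn ler_pdivrMr ?ltr0n// (le_trans ab)//.
rewrite mulrAC ler_wpM2r ?exprn_ge0// -natrM ler_nat; lia.
Qed.

Lemma cyl_term_bound x y r : cmod x <= r -> cmod y <= r -> geo_bound 2 r (cyl_term x y).
Proof.
move=> xr yr n; apply: natmul_div_bound.
- exact: le_trans (cmod_ge0 x) xr.
- case: n => [|n]; [left|by right].
  by rewrite /cauchy_prod big_ord1 /pterm !tterm0 subrr mul0r.
- by apply: cauchy_prod_bound; apply: pterm_bound.
Qed.

(** The constant is [2 + 1 + 1 + 1], one contribution from each summand of [log_term]. *)
Lemma log_term_bound x y r : 0 <= r -> cmod x <= r -> cmod y <= r ->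
  geo_bound 5 r (log_term x y).
Proof.
move=> r0 xr yr n; rewrite /log_term.
have h1 := cyl_term_bound xr yr n.
have h2 := zterm_bound_le xr n.
have h3 := zterm_bound_le yr n.
have h4 : cmod ((n == 0)%:R : C) <= r ^+ n.
  by case: n {h1 h2 h3} => [|n] /=; rewrite ?cmod0 ?exprn_ge0// cmod_nat expr0.
apply: le_trans (cmodB _ _) _.
have := cmodD (cyl_term x y n + zterm x n) (zterm y n).
have := cmodD (cyl_term x y n) (zterm x n).
lra.
Qed.

Lemma log_term0 x y : log_term x y 0 = - 1.
Proof. by rewrite /log_term /cyl_term invr0 mulr0 !zterm0 !addr0 sub0r. Qed.

Lemma max_cmod_itv x y : `|x| < 1 -> `|y| < 1 -> 0 <= Num.max (cmod x) (cmod y) < 1.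
Proof.
by move=> /cmod_lt1 x1 /cmod_lt1 y1; rewrite le_max cmod_ge0 gt_max x1 y1.
Qed.

(* From [t z = t - 1]: [t1 t2 (z1 - z2) = t1 - t2 = theta (z1 - z2)]. *)
Lemma exp_log_series x y : `|x| < 1 -> `|y| < 1 -> x != y ->
  cexp (limn (series (log_term x y))) = (z_of x - z_of y) / (x - y).
Proof.
move=> x1 y1 xy; have xy0 : x - y != 0 by rewrite subr_eq0.
have r01 := max_cmod_itv x1 y1; set r := Num.max _ _ in r01.
have /andP[r0 _] := r01.
have xr : cmod x <= r by rewrite le_max lexx.
have yr : cmod y <= r by rewrite le_max lexx orbT.
pose w n := zterm x n - zterm y n.
have wb : geo_bound 2 r w.
  move=> n; apply: le_trans (cmodB _ _) _.
  by have := zterm_bound_le xr n; have := zterm_bound_le yr n; lra.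
pose a := (x - y)^-1; pose c := 5 + cmod a * 2 * r.
have c5 : 5 <= c by rewrite lerDl !mulr_ge0 ?cmod_ge0.
have ac : cmod a * 2 * r <= c by rewrite lerDr.
have cz := cvg_zterm x1; rewrite -z_ofE in cz.
have cz' := cvg_zterm y1; rewrite -z_ofE in cz'.
have cw : series w @ \oo --> z_of x - z_of y by exact: cvg_seriesB cz cz'.
have <- : limn (series w) = z_of x - z_of y by exact: (cvg_lim (@norm_hausdorff _ _) cw).
rewrite mulrC -/a.
apply: esym.
(* Here [u = t1 t2], [p = P] and [w = z1 - z2]; the factor [a] makes the first coefficient
   [1 / e = exp (- 1)]. *)
apply: (@exp_series_shift _ c r (cauchy_prod (tterm x) (tterm y)) (log_term x y) w a).
- exact: r01.
- exact: geo_bound_weaken r0 c5 (log_term_bound r0 xr yr).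
- exact: geo_bound_weaken r0 ac (geo_bound_shift _ r0 wb).
- by rewrite /w !zterm0 subrr.
- by rewrite log_term0 /w !zterm1 -mulrBr mulrCA mulVf// mulr1.
- exact: euler_log_term.
- move=> n; rewrite /w cauchy_prodBr mulrBr !euler_zterm.
  rewrite -(cauchy_prodA _ _ (zterm y)) [cauchy_prod (tterm y) (zterm y)]cauchy_prodC.
  rewrite cauchy_zterm_tterm [cauchy_prod (tterm x) (tterm y)]cauchy_prodC.
  rewrite -cauchy_prodA [cauchy_prod (tterm x) (zterm x)]cauchy_prodC cauchy_zterm_tterm.
  rewrite !cauchy_prodBr [cauchy_prod (tterm y) (tterm x)]cauchy_prodC.
  rewrite ![cauchy_prod _ (fun n => (n == 0)%:R)]cauchy_prodC !cauchy_prod1l.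
  by ring.
- exact: cvgP cw.
Qed.

End UnstableSeries.

(** * Continuity of the sum of [P] on the open bidisc *)

Section LogContinuity.
Variable R : realType.
Local Notation C := (Cplx R).
Variables (T : Type) (F : set_system T).
Hypothesis FF : Filter F.
Implicit Types (a b : T -> C) (x y : C).

Lemma cvg_sum_seq (I : Type) (s : seq I) (f : I -> T -> C) (l : I -> C) :
  (forall i, f i @ F --> l i) ->
  \sum_(i <- s) f i t @[t --> F] --> \sum_(i <- s) l i.
Proof.
move=> fl; elim: s => [|i s IH].
  rewrite big_nil; under eq_fun do rewrite big_nil.
  exact: cvg_cst.
rewrite big_cons; under eq_fun do rewrite big_cons.
exact: (cvgD (fl i) IH).
Qed.

Lemma cvg_exprn a x n : a @ F --> x -> a t ^+ n @[t --> F] --> x ^+ n.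
Proof.
move=> ax; elim: n => [|n IH].
  by under eq_fun do rewrite expr0; rewrite expr0; exact: cvg_cst.
under eq_fun do rewrite exprS.
by rewrite exprS; exact: (cvgM ax IH).
Qed.

Lemma cvg_tterm_arg a x n : a @ F --> x -> tterm (a t) n @[t --> F] --> tterm x n.
Proof.
move=> ax; have h : cexp (- 1) * a t @[t --> F] --> cexp (- 1) * x.
  exact: (cvgM (cvg_cst _) ax).
exact: (cvgM (cvg_cst _) (cvg_exprn (n := n) h)).
Qed.

Lemma cvg_zterm_arg a x n : a @ F --> x -> zterm (a t) n @[t --> F] --> zterm x n.
Proof. move=> /(cvg_tterm_arg (n := n)) h; exact: (cvgM h (cvg_cst _)). Qed.

Lemma cvg_pterm_arg a x n : a @ F --> x -> pterm (a t) n @[t --> F] --> pterm x n.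
Proof. move=> /(cvg_tterm_arg (n := n)) h; exact: (cvgB h (cvg_cst _)). Qed.

Lemma cvg_log_term_arg a b x y n : a @ F --> x -> b @ F --> y ->
  log_term (a t) (b t) n @[t --> F] --> log_term x y n.
Proof.
move=> ax bx.
have hc : cyl_term (a t) (b t) n @[t --> F] --> cyl_term x y n.
  have h : cauchy_prod (pterm (a t)) (pterm (b t)) n @[t --> F] -->
      cauchy_prod (pterm x) (pterm y) n.
    rewrite /cauchy_prod.
    apply: (@cvg_sum_seq _ _ (fun (i : 'I_n.+1) t => pterm (a t) i * pterm (b t) (n - i)%N)
      (fun i : 'I_n.+1 => pterm x i * pterm y (n - i)%N)) => i.
    exact: (cvgM (cvg_pterm_arg (n := i) ax) (cvg_pterm_arg (n := (n - i)%N) bx)).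
  exact: (cvgM h (cvg_cst _)).
exact: (cvgB (cvgD (cvgD hc (cvg_zterm_arg (n := n) ax)) (cvg_zterm_arg (n := n) bx))
  (cvg_cst _)).
Qed.

(* Weierstrass M-test on the bidisc of radius [r]. *)
Lemma cvg_lim_log_series a b x y : `|x| < 1 -> `|y| < 1 -> a @ F --> x -> b @ F --> y ->
  limn (series (log_term (a t) (b t))) @[t --> F] --> limn (series (log_term x y)).
Proof.
move=> x1 y1 ax bx; have /andP[m0 m1] := max_cmod_itv x1 y1.
(* With [r] strictly between [m] and 1, points near [(x, y)] stay in the bidisc of radius [r], and
   one tail bound serves them all. *)
set m := Num.max _ _ in m0 m1; pose r := (1 + m) / 2.
have mr : m < r by rewrite /r; lra.
have r01 : 0 <= r < 1 by rewrite /r; apply/andP; split; lra.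
have /andP[r0 r1] := r01.
have xm : cmod x <= m by rewrite le_max lexx.
have ym : cmod y <= m by rewrite le_max lexx orbT.
have near_r (f : T -> C) (z : C) : cmod z <= m -> f @ F --> z ->
    \forall t \near F, cmod (f t) <= r.
  move=> zm /cplx_cvgP/(_ (r - m)); rewrite subr_gt0 => /(_ mr) H.
  apply: filterS H => t; rewrite cmod_distrC => H.
  by have := cmodD z (f t - z); rewrite addrC subrK; lra.
apply/cplx_cvgP => e e0.
have e3 : 0 < e / 3 by rewrite divr_gt0.
have [N HN] := geo_tail_lt 5 r01 e3.
have hs : series (log_term (a t) (b t)) N @[t --> F] --> series (log_term x y) N.
  apply: (@cvg_sum_seq _ _ (fun i t => log_term (a t) (b t) i) (log_term x y)) => i.
  exact: cvg_log_term_arg.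
have /cplx_cvgP/(_ _ e3) hs' := hs.
apply: filterS (filterI (filterI (near_r _ _ xm ax) (near_r _ _ ym bx)) hs').
move=> t [[ar br] hst].
have tail1 := geo_tail N r01 (log_term_bound r0 ar br).
have tail2 := geo_tail N r01 (log_term_bound r0 (le_trans xm (ltW mr)) (le_trans ym (ltW mr))).
set L := limn (series (log_term x y)) in tail2 *.
set L' := limn (series (log_term (a t) (b t))) in tail1 *.
set s := series _ N in tail2 hst; set s' := series _ N in tail1 hst.
have -> : L - L' = (L - s) + (s - s') - (L' - s') by ring.
have := cmodB ((L - s) + (s - s')) (L' - s').
have := cmodD (L - s) (s - s').
lra.
Qed.

End LogContinuity.

(** * Unordered sums computed degree by degree *)

Section GradedSums.
Variables (R : realType) (I : choiceType).
Local Notation C := (Cplx R).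
Variables (deg : I -> nat) (fib : nat -> seq I).
Hypothesis fib_uniq : forall n, uniq (fib n).
Hypothesis fibP : forall n i, (i \in fib n) = (deg i == n).

Let below M := flatten [seq fib n | n <- iota 0 M].

Lemma belowS M : below M.+1 = below M ++ fib M.
Proof. by rewrite /below -addn1 iotaD map_cat flatten_cat /= cats0. Qed.

Lemma mem_below M i : (i \in below M) = (deg i < M)%N.
Proof.
elim: M => [|M IH]; first by rewrite in_nil.
by rewrite belowS mem_cat IH fibP ltnS [in RHS]leq_eqVlt orbC.
Qed.

Lemma below_uniq M : uniq (below M).
Proof.
elim: M => [|M IH] //; rewrite belowS cat_uniq IH fib_uniq andbT /=.
by apply/hasPn => i; rewrite fibP mem_below => /eqP ->; rewrite ltnn.
Qed.

Lemma sum_below (V : zmodType) (P : pred I) (f : I -> V) M :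
  \sum_(i <- below M | P i) f i = \sum_(0 <= n < M) \sum_(i <- fib n | P i) f i.
Proof.
elim: M => [|M IH]; first by rewrite !big_nil.
by rewrite belowS big_cat big_nat_recr//= IH.
Qed.

Lemma partial_sum_seq (a : I -> C) (A : {fset I}) :
  partial_sum a A = \sum_(i <- A) a i.
Proof. by rewrite /partial_sum big_seq_fsetE. Qed.

(** A finite set containing every index of degree below [N] misses only terms of degree at least
    [N], whose absolute sum is at most a geometric tail. *)
Lemma cvg_partial_sum_graded (a : I -> C) c r : 0 <= r < 1 ->
  (forall n, \sum_(i <- fib n) cmod (a i) <= c * r ^+ n) ->
  partial_sum a @ totally --> limn (series (fun n => \sum_(i <- fib n) a i)).
Proof.
move=> r01 ab; set u := fun n => _.
have ub : geo_bound c r u by move=> n; apply: le_trans (cmod_sum _ _ _) (ab n).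
have /andP[r0 r1] := r01; have c0 := geo_bound_ge0 ub.
have r1' : 0 < 1 - r by rewrite subr_gt0.
pose S n := \sum_(i <- fib n) cmod (a i).
have FF : Filter (@totally I) := @filter_filter _ _ (@totally_filter I).
apply/cplx_cvgP => e e0.
have e2 : 0 < e / 2 by rewrite divr_gt0.
have [N HN] := geo_tail_lt c r01 e2.
exists [fset i in below N]%fset => //= B /fsubsetP AB.
(* [M] is at least [N] and exceeds every degree in [B], so [B] lies in [below M] and the partial sum
   splits along [B]. *)
pose M := (N + \max_(i <- B) (deg i).+1)%N.
have BM i : i \in B -> i \in below M.
  move=> iB; rewrite mem_below /M (leq_trans _ (leq_addl _ _))//.
  exact: (leq_bigmax_seq (F := fun i => (deg i).+1)).
have sB : \sum_(i <- below M | i \in B) a i = \sum_(i <- B) a i.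
  rewrite -big_filter; apply: perm_big; apply: uniq_perm.
  - by rewrite filter_uniq ?below_uniq.
  - exact: fset_uniq.
  - by move=> i; rewrite mem_filter; apply/andP/idP => [[]//|iB]; split=> //; exact: BM.
have sM : series u M = \sum_(i <- below M | i \in B) a i + \sum_(i <- below M | i \notin B) a i.
  by rewrite /series /= -(sum_below xpredT a M) (bigID (mem B)).
have nB : cmod (\sum_(i <- below M | i \notin B) a i) <= c * r ^+ N / (1 - r).
  apply: le_trans (cmod_sum _ _ _) _.
  apply: (@le_trans _ _ (\sum_(i <- below M | (N <= deg i)%N) cmod (a i))).
    rewrite big_mkcond [leRHS]big_mkcond; apply: ler_sum => i _ /=.
    have := AB i; rewrite in_fset /= mem_below.
    case: (i \in B) => /= h; first by case: ifP => // _; exact: cmod_ge0.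
    by case: leqP => // /h.
  rewrite sum_below (@big_cat_nat _ _ _ N) ?leq_addr//=.
  rewrite big_nat big1 ?add0r => [|n /andP[_ nN]]; last first.
    rewrite big_seq_cond big1// => i /andP[]; rewrite fibP => /eqP ->.
    by rewrite leqNgt nN.
  have Sb : geo_bound c r (fun n => (S n)%:C%C : C).
    by move=> n; rewrite cmod_real ger0_norm ?ab// sumr_ge0// => i _; exact: cmod_ge0.
  apply: le_trans (geo_block N M r01 Sb); apply: ler_sum_nat => n /andP[Nn _].
  rewrite cmod_real; apply: le_trans (ler_norm _).
  rewrite /S big_mkcond; apply: ler_sum => i _; case: ifP => // _; exact: cmod_ge0.
rewrite partial_sum_seq -sB.
have -> : limn (series u) - \sum_(i <- below M | i \in B) a i =
    (limn (series u) - series u M) + \sum_(i <- below M | i \notin B) a i.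
  by rewrite sM; ring.
have t1 := geo_tail M r01 ub.
have t2 : c * r ^+ M / (1 - r) <= c * r ^+ N / (1 - r).
  rewrite ler_pM2r ?invr_gt0// ler_wpM2l// ler_wiXn2l// ?(ltW r1)//.
  exact: leq_addr.
have := cmodD (limn (series u) - series u M) (\sum_(i <- below M | i \notin B) a i).
lra.
Qed.

End GradedSums.

(** * Laplace terms grouped by degree *)

Section Fibers.
Variable R : realType.
Hypothesis H01 : forall d : nat, (0 < d)%N ->
  hurwitz_H R 0 [tuple d] = d%:R ^ (d%:Z - 2) / (d`!)%:R.
Hypothesis H02 : forall a b : nat, (0 < a)%N -> (0 < b)%N ->
  hurwitz_H R 0 [tuple a; b] =
    1 / (a + b)%:R * ((a ^ a)%:R / (a`!)%:R) * ((b ^ b)%:R / (b`!)%:R).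
Local Notation C := (Cplx R).
Implicit Types (x y : C) (n : nat).

Definition posS n : posint := exist _ n.+1 isT.

Definition degree (k : nat) (m : k.-tuple posint) : nat := sumn (parts m).

Definition fiber1 n : seq (1.-tuple posint) :=
  if n is n'.+1 then [:: [tuple posS n']] else [::].

(** The pairs [(i + 1, n - (i + 1))]: [posS] adds one back to [n - i.+2], and [i < n.-1] keeps the
    second part positive. *)
Definition fiber2 n : seq (2.-tuple posint) :=
  [seq [tuple posS i; posS (n - i.+2)] | i <- iota 0 n.-1].

Lemma posS_pred (k : posint) : posS (sval k).-1 = k.
Proof. by apply: val_inj; case: k => [[]]. Qed.

Lemma fiber1_uniq n : uniq (fiber1 n).
Proof. by case: n. Qed.

Lemma fiber1P n m : (m \in fiber1 n) = (degree m == n).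
Proof.
case/tupleP: m => k m; rewrite tuple0 /degree /= addn0.
case: n => [|n]; first by case: k => [[]].
rewrite inE; apply/eqP/eqP => [[->]//|kn]; apply: val_inj => /=.
by rewrite -[k]posS_pred kn.
Qed.

Lemma fiber2_uniq n : uniq (fiber2 n).
Proof.
by rewrite map_inj_in_uniq ?iota_uniq// => i j _ _ [->].
Qed.

Lemma fiber2P n m : (m \in fiber2 n) = (degree m == n).
Proof.
case/tupleP: m => a m; case/tupleP: m => b m; rewrite tuple0 /degree /= addn0.
apply/mapP/eqP => [[i ilt /(congr1 val) /= e]|abn].
  by move: ilt; case: e => -> ->; rewrite mem_iota add0n /=; lia.
rewrite -[a]posS_pred -[b]posS_pred in abn *.
move: (sval a).-1 (sval b).-1 abn => {a b} i j /= <-.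
exists i; first by rewrite mem_iota; lia.
apply: val_inj => /=; congr [:: _; posS _]; lia.
Qed.

Lemma laplace_term1 x n :
  laplace_term_x 0 [tuple x] [tuple posS n] = disk_term x n.+1.
Proof.
rewrite /laplace_term_x big_ord1 /=.
have -> : parts [tuple posS n] = [tuple n.+1] by apply: val_inj.
rewrite H01// !(tnth_nth 0) /= cexpN_nat -exprMn.
(* The integer exponent [d - 2] is negative at [d = 1], so the power is rewritten as
   [d ^ d / d ^ 2]; the two divisions by [d] are those of [zterm] and [disk_term]. *)
have -> : n.+1%:R ^ (n.+1%:Z - 2) = (n.+1 ^ n.+1)%:R / n.+1%:R ^+ 2 :> rat.
  by rewrite expfzDr ?pnatr_eq0// natrX.
rewrite !fmorph_div rmorphXn /= !ratr_nat.
rewrite /disk_term /zterm /tterm /tree_coef; field.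
by rewrite fact_neq0 nat1r pnatr_eq0.
Qed.

Lemma laplace_term2 x y i j :
  laplace_term_x 0 [tuple x; y] [tuple posS i; posS j] =
  tterm x i.+1 * tterm y j.+1 / (i.+1 + j.+1)%:R.
Proof.
rewrite /laplace_term_x.
have -> : parts [tuple posS i; posS j] = [tuple i.+1; j.+1] by apply: val_inj.
rewrite H02// big_ord_recl big_ord1 !(tnth_nth 0) /= !cexpN_nat -!exprMn.
rewrite !rmorphM !fmorphV /= rmorph1 !ratr_nat /tterm /tree_coef.
have : (i.+1 + j.+1)%:R != 0 :> C by rewrite pnatr_eq0.
by move: (i.+1 + j.+1)%:R => s s0; field; rewrite s0 !fact_neq0.
Qed.

Lemma cvg_partial_sum1 x : `|x| < 1 ->
  partial_sum (laplace_term_x 0 [tuple x]) @ totally --> 1 / 2 * (1 - 1 / t_of x ^+ 2).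
Proof.
move=> x1; have r01 : 0 <= cmod x < 1 by rewrite cmod_ge0 cmod_lt1.
have <- := cvg_lim (@norm_hausdorff _ _) (cvg_disk x1).
have -> : disk_term x = fun n => \sum_(m <- fiber1 n) laplace_term_x 0 [tuple x] m.
  apply/funext => -[|n] /=; first by rewrite big_nil /disk_term invr0 mulr0.
  by rewrite big_seq1 laplace_term1.
apply: (cvg_partial_sum_graded (deg := @degree 1) fiber1_uniq fiber1P (c := 1) r01).
move=> [|n] /=; first by rewrite big_nil mulr_ge0 ?exprn_ge0 ?cmod_ge0.
rewrite big_seq1 laplace_term1//; apply: le_trans (zterm_bound x n.+1).
exact: cmod_divn_le.
Qed.

(** The two end terms of the Cauchy product vanish because [pterm] has no constant term; the others
    are indexed by pairs of positive parts. *)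
Lemma sum_fiber2 x y n :
  \sum_(m <- fiber2 n) laplace_term_x 0 [tuple x; y] m = cyl_term x y n.
Proof.
have p0 z : pterm z 0 = 0 by rewrite /pterm tterm0 subrr.
rewrite big_map /cyl_term /cauchy_prod big_ord_recl p0 mul0r add0r.
case: n => [|n]; first by rewrite big_nil big_ord0 mul0r.
rewrite big_ord_recr /= /bump /= ?add1n subnn p0 mulr0 addr0 mulr_suml.
rewrite -(big_mkord xpredT (fun i => pterm x i.+1 * pterm y (n.+1 - i.+1) / n.+1%:R)).
rewrite /index_iota subn0 big_seq [RHS]big_seq; apply: eq_bigr => i.
rewrite mem_iota add0n => /andP[_ ilt].
rewrite laplace_term2 // !subSS /pterm !subr0.
have -> : (n - i = (n - i.+1).+1)%N by lia.
rewrite subr0; congr (_ / _%:R); lia.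
Qed.

Lemma cvg_partial_sum2 x y : `|x| < 1 -> `|y| < 1 ->
  partial_sum (laplace_term_x 0 [tuple x; y]) @ totally -->
  limn (series (log_term x y)) - (z_of x + z_of y) + 1.
Proof.
move=> x1 y1; have r01 := max_cmod_itv x1 y1; set r := Num.max _ _ in r01.
have /andP[r0 _] := r01.
have xr : cmod x <= r by rewrite le_max lexx.
have yr : cmod y <= r by rewrite le_max lexx orbT.
have cl := geo_cvg r01 (log_term_bound r0 xr yr).
have cx := cvg_zterm x1; rewrite -z_ofE in cx.
have cy := cvg_zterm y1; rewrite -z_ofE in cy.
have cc := cvg_seriesD (cvg_seriesB cl (cvg_seriesD cx cy)) (@cvg_series_delta R).
have <- := cvg_lim (@norm_hausdorff _ _) cc.
rewrite (_ : (fun n => _) = fun n => \sum_(m <- fiber2 n) laplace_term_x 0 [tuple x; y] m);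
  last by apply/funext => n; rewrite sum_fiber2 /log_term; ring.
apply: (cvg_partial_sum_graded (deg := @degree 2) fiber2_uniq fiber2P (c := 1) r01).
move=> n; rewrite big_map mul1r.
case: n => [|n]; first by rewrite big_nil exprn_ge0.
(* Degree [n + 1] has [n] pairs, and the factor [1 / (a + b)] absorbs their number; hence the
   constant 1. *)
apply: (@le_trans _ _ (\sum_(i <- iota 0 n) r ^+ n.+1 / n.+1%:R)); last first.
  rewrite big_const_seq count_predT size_iota iter_addr_0 -[leLHS]mulr_natr -mulrA.
  by rewrite ler_piMr ?exprn_ge0// mulrC ler_pdivrMr ?ltr0n// mul1r ler_nat.
rewrite big_seq [leRHS]big_seq; apply: ler_sum => i; rewrite mem_iota add0n /= => ilt.
rewrite laplace_term2// (_ : (i.+1 + _ = n.+1)%N); last by lia.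
rewrite cmod_divn ler_wpM2r ?invr_ge0// cmodM.
rewrite [in leRHS](_ : n.+1 = (i.+1 + (n.+1 - i.+2).+1)%N); last by lia.
rewrite exprD ler_pM ?cmod_ge0//.
  by rewrite -[leRHS]mul1r; apply: tterm_bound_le.
by rewrite -[leRHS]mul1r; apply: tterm_bound_le.
Qed.

End Fibers.

(** * Change of variable and the branch of the logarithm *)

Section LogBranch.
Variable R : realType.
Local Notation C := (Cplx R).

(** The sums agree term by term, by [exp (- m (w + 1)) = exp (- m) (exp (- w)) ^ m]. *)
Lemma laplace_F_Fx (g n : nat) (w : n.-tuple C) :
  laplace_F g w = laplace_Fx g (map_tuple (fun u => cexp (- u)) w).
Proof.
congr (sum _); apply/funext => m; rewrite /laplace_term /laplace_term_x.
congr (_ * _); rewrite -sumrN (big_morph (@cexp R) (@cexpD R) (@cexp0 R)).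
apply: eq_bigr => i _; rewrite [tnth (map_tuple _ w) i]tnth_map mulrDr mulr1 opprD addrC cexpD.
by rewrite -cexpMn mulrN.
Qed.

(** Taking the sum of [P] itself, instead of a logarithm of the quotient, gives a single-valued
    function that is also defined on the diagonal, where the quotient reads [0 / 0]. *)
Definition log_branch (p : C * C) : C := limn (series (log_term p.1 p.2)).

Lemma log_branch_spec : log_quotient_branch log_branch.
Proof.
split=> [x1 x2 x11 x21||x1 x2 x11 x21 x12].
- exact: (@cvg_lim_log_series R _ (nbhs (x1, x2)) _ fst snd x1 x2 x11 x21 cvg_fst cvg_snd).
(* At the origin the ratio [r = 0] is allowed, so the tail after one term is 0 and the sum is its
   first term [- 1]. *)
- have c0 : cmod (0 : C) <= 0 by rewrite cmod0.
  have r01 : 0 <= (0 : R) < 1 by rewrite lexx ltr01.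
  have := geo_tail 1 r01 (log_term_bound (lexx 0) c0 c0).
  have -> : series (log_term (0 : C) 0) 1 = - 1 by rewrite /series /= big_nat1 log_term0.
  rewrite expr1 mulr0 mul0r => h.
  apply/eqP; rewrite -subr_eq0 -normr_eq0 cmodE.
  by apply/eqP/(congr1 (real_complex R)); apply/eqP; rewrite eq_le h cmod_ge0.
- exact: exp_log_series.
Qed.

End LogBranch.

Theorem theorem6p3 (R : realType)
  (H01 : forall d : nat, (0 < d)%N ->
     hurwitz_H R 0 [tuple d] = d%:R ^ (d%:Z - 2) / (d`!)%:R)
  (H02 : forall a b : nat, (0 < a)%N -> (0 < b)%N ->
     hurwitz_H R 0 [tuple a; b] =
       1 / (a + b)%:R * ((a ^ a)%:R / (a`!)%:R) * ((b ^ b)%:R / (b`!)%:R)) :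
  [/\ forall (g n : nat) (w : n.-tuple (Cplx R)),
        laplace_F g w = laplace_Fx g (map_tuple (fun u => cexp (- u)) w),
      forall x : Cplx R, `|x| < 1 ->
        [/\ t_of x != 0, x = z_of x * cexp (1 - z_of x) &
            z_of x = (t_of x - 1) / t_of x],
      forall x : Cplx R, `|x| < 1 ->
        sum_converges (laplace_term_x 0 [tuple x]) /\
        laplace_Fx 0 [tuple x] = 1 / 2 * (1 - 1 / t_of x ^+ 2) &
      exists L : Cplx R * Cplx R -> Cplx R,
        log_quotient_branch L /\
        forall x1 x2 : Cplx R, `|x1| < 1 -> `|x2| < 1 ->
          sum_converges (laplace_term_x 0 [tuple x1; x2]) /\
          laplace_Fx 0 [tuple x1; x2] = L (x1, x2) - (z_of x1 + z_of x2) + 1].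
Proof.
split.
- exact: laplace_F_Fx.
- by move=> x x1; split; [exact: t_of_neq0 | exact: z_of_tree | exact: z_of_t].
- move=> x x1; have h := cvg_partial_sum1 H01 x1.
  by split; [exact: cvgP h | exact: (@cvg_lim _ (@norm_hausdorff _ _) _ _ (@totally_filter _) _ _ h)].
- exists (@log_branch R); split; first exact: log_branch_spec.
  move=> x1 x2 x11 x21; have h := cvg_partial_sum2 H02 x11 x21.
  by split; [exact: cvgP h | exact: (@cvg_lim _ (@norm_hausdorff _ _) _ _ (@totally_filter _) _ _ h)].
Qed.
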